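(* Let $A$ be a Banach algebra and let $I$ be a left Banach $A$-module. The following properties are equivalent: (i) $I$ is injective. (ii) The topology on $\operatorname{Ext}^1_A(X,I)$ is trivial for each left Banach $A$-module $X$. (iii) For all left Banach $A$-modules $X,Y$, each admissible monomorphism $\varkappa\colon Y\to X$ and each morphism $\varphi\colon Y\to I$ of left Banach $A$-modules, there exists a net $\{\varphi_\nu\}$ in ${}_A\mathbf h(X,I)$ such that $\varphi_\nu\varkappa\to\varphi$ in the norm topology. (Equivalently, for each admissible monomorphism $Y\to X$ of left Banach $A$-modules the induced map ${}_A\mathbf h(X,I)\to{}_A\mathbf h(Y,I)$ has dense range.) (iv) For all $X,Y,\varkappa,\varphi$ as described in (iii), there exists a uniform approximate morphism $\{\psi_\nu\}$ in $\mathscr B(X,I)$ such that $\psi_\nu\varkappa=\varphi$ for all $\nu$. (v) For all $X,Y,\varkappa,\varphi$ as described in (iii), there exists a uniform approximate morphism $\{\psi_\nu\}$ in $\mathscr B(X,I)$ such that $\psi_\nu\varkappa\to\varphi$ in the norm topology. (vi) There exist an injective left Banach $A$-module $J$, an admissible monomorphism $\mu\colon I\to J$ and a uniform approximate morphism $\{\rho_\nu\}$ in $\mathscr B(J,I)$ such that $\rho_\nu\mu\to\mathbf 1_I$ in the norm topology. (vii) For each left Banach $A$-module $X$ and each $f\in Z^1(A\times X,I)$, there exists a net $\{T_\nu\}$ in $\mathscr B(X,I)$ such that $\delta^0T_\nu\to f$ in the norm topology.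
   Context: Banach algebras are not assumed unital. A left Banach $A$-module is a Banach space with a jointly continuous bilinear associative left action of $A$; morphisms are bounded linear $A$-module maps. $\mathscr B(X,Y)$ is the Banach space of bounded linear operators $X\to Y$, and ${}_A\mathbf h(X,Y)\subset\mathscr B(X,Y)$ is the closed subspace of left $A$-module morphisms. $\mathbf 1_I$ is the identity operator. A chain complex of Banach modules is admissible if it splits as a complex of Banach spaces. A morphism is an admissible monomorphism if it fits as the map $X\to Y$ into a short admissible sequence $0\to X\to Y\to Z\to0$ of modules, i.e. it has a bounded linear left inverse. $I$ is injective if for each admissible monomorphism $Y\to X$ of left Banach $A$-modules the induced map ${}_A\mathbf h(X,I)\to{}_A\mathbf h(Y,I)$ is onto. $P$ is projective if for each admissible epimorphism $X\to Y$ (a surjective morphism with a bounded linear right inverse) the induced map ${}_A\mathbf h(P,X)\to{}_A\mathbf h(P,Y)$ is onto. A projective resolution of $X$ is a chain complex $P_\bullet=(P_n,d_n)_{n\ge0}$ of projective modules with a morphism $P_0\to X$ such that the augmented sequence $P_\bullet\to X\to0$ is admissible. $\operatorname{Ext}^n_A(X,Y)$ is the $n$th cohomology of the complex ${}_A\mathbf h(P_\bullet,Y)$ (equivalently, of ${}_A\mathbf h(X,I^\bullet)$ with $I^\bullet$ an injective resolution of $Y$, defined dually), seminormed by the quotient seminorm (cocycles modulo coboundaries); its topology does not depend on the choice of resolution. The topology is trivial if it is indiscrete, i.e. the coboundaries are dense in the cocycles. $Z^1(A\times X,Y)$ is the Banach space of continuous bilinear maps $f\colon A\times X\to Y$ with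 $a\cdot f(b,x)-f(ab,x)+f(a,b\cdot x)=0$ for all $a,b\in A$, $x\in X$. The map $\delta^0\colon\mathscr B(X,Y)\to Z^1(A\times X,Y)$ is $(\delta^0T)(a,x)=a\cdot T(x)-T(a\cdot x)$. One has topologically $\operatorname{Ext}^1_A(X,Y)=Z^1(A\times X,Y)/\operatorname{Im}\delta^0$. A uniform approximate morphism from $X$ to $Y$ is a net $\{\varphi_\nu\}$ in $\mathscr B(X,Y)$ such that $\varphi_\nu(a\cdot x)-a\cdot\varphi_\nu(x)\to0$ uniformly on bounded subsets of $A$ and $X$ (i.e. uniformly for $a,x$ ranging over bounded sets). *)

(* Defs.v *)
From Stdlib Require Import Reals.
From Coquelicot Require Import Coquelicot.

Set Implicit Arguments.
Unset Strict Implicit.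
Unset Printing Implicit Defensive.

Open Scope R_scope.

(** The ground field is the field of complex numbers. *)

Notation BanachSpace := (CompleteNormedModule C_AbsRing).

(** [is_linear] includes boundedness. *)
Record BoundedOp (X Y : BanachSpace) := {
  op_fun :> X -> Y;
  op_linear : is_linear op_fun
}.

(** Both suprema below are finite on the maps they are applied to (bounded
    linear, resp. continuous bilinear maps); elsewhere they are junk. *)
Definition opnorm {X Y : BanachSpace} (f : X -> Y) : R :=
  real (Lub_Rbar (fun r => exists x : X, norm x <= 1 /\ r = norm (f x))).

Definition bilnorm {X Y Z : BanachSpace} (f : X -> Y -> Z) : R :=
  real (Lub_Rbar (fun r => exists (x : X) (y : Y),
    norm x <= 1 /\ norm y <= 1 /\ r = norm (f x y))).

Record is_bilinear {X Y Z : BanachSpace} (f : X -> Y -> Z) : Prop := {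
  bilinear_plus_l : forall x x' y, f (plus x x') y = plus (f x y) (f x' y);
  bilinear_scal_l : forall (k : C) x y, f (scal k x) y = scal k (f x y);
  bilinear_plus_r : forall x y y', f x (plus y y') = plus (f x y) (f x y');
  bilinear_scal_r : forall (k : C) x y, f x (scal k y) = scal k (f x y)
}.

Definition jointly_continuous {X Y Z : BanachSpace} (f : X -> Y -> Z) : Prop :=
  forall p : X * Y, continuous (fun q : X * Y => f (fst q) (snd q)) p.

Definition bounded_set {X : BanachSpace} (S : X -> Prop) : Prop :=
  exists M : R, forall x, S x -> norm x <= M.

(** Not assumed unital. *)
Record BanachAlgebra := {
  alg_space :> BanachSpace;
  alg_mul : alg_space -> alg_space -> alg_space;
  alg_mul_bilinear : is_bilinear alg_mul;
  alg_mul_assoc : forall a b c,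
    alg_mul a (alg_mul b c) = alg_mul (alg_mul a b) c;
  alg_mul_norm : forall a b, norm (alg_mul a b) <= norm a * norm b
}.

Record LeftModule (A : BanachAlgebra) := {
  mod_space :> BanachSpace;
  act : A -> mod_space -> mod_space;
  act_bilinear : is_bilinear act;
  act_continuous : jointly_continuous act;
  act_assoc : forall (a b : A) (x : mod_space),
    act (alg_mul a b) x = act a (act b x)
}.

Record Hom (A : BanachAlgebra) (X Y : LeftModule A) := {
  hom_op :> BoundedOp X Y;
  hom_act : forall (a : A) (x : X), hom_op (act a x) = act a (hom_op x)
}.

Section Modules.

Variable A : BanachAlgebra.
Implicit Types X Y I P : LeftModule A.

Definition admissible_mono Y X (k : Hom Y X) : Prop :=
  exists s : BoundedOp X Y, forall y, s (k y) = y.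

Definition admissible_epi X Y (p : Hom X Y) : Prop :=
  (forall y, exists x, p x = y) /\
  exists s : BoundedOp Y X, forall y, p (s y) = y.

Definition injective I : Prop :=
  forall X Y (k : Hom Y X), admissible_mono k ->
  forall f : Hom Y I, exists g : Hom X I, forall y, g (k y) = f y.

Definition projective P : Prop :=
  forall X Y (p : Hom X Y), admissible_epi p ->
  forall f : Hom P Y, exists g : Hom P X, forall x, p (g x) = f x.

Record ChainComplex := {
  ob :> nat -> LeftModule A;
  diff : forall n, Hom (ob (S n)) (ob n);
  diff_diff : forall n x, diff n (diff (S n) x) = zero
}.

(** Splitting as a complex of Banach spaces: a contracting homotopy of bounded
    linear operators. *)
Definition admissible (K : ChainComplex) : Prop :=
  exists s : forall n, BoundedOp (K n) (K (S n)),
    (forall x, diff K 0 (s 0%nat x) = x) /\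
    (forall n x,
       plus (s n (diff K n x)) (diff K (S n) (s (S n) x)) = x).

Section Augmentation.

Variables (K : ChainComplex) (X : LeftModule A) (e : Hom (K 0%nat) X).
Hypothesis e_diff : forall x, e (diff K 0 x) = zero.

Definition augment_ob (n : nat) : LeftModule A :=
  match n with O => X | S m => K m end.

Definition augment_diff (n : nat) : Hom (augment_ob (S n)) (augment_ob n) :=
  match n return Hom (augment_ob (S n)) (augment_ob n) with
  | O => e
  | S m => diff K m
  end.

Lemma augment_diff_diff n x : augment_diff n (augment_diff (S n) x) = zero.
Proof.
destruct n as [|n].
- exact (e_diff x).
- exact (diff_diff x).
Qed.

Definition augment : ChainComplex :=
  {| ob := augment_ob; diff := augment_diff; diff_diff := augment_diff_diff |}.

End Augmentation.

Record ProjectiveResolution X := {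
  res_complex :> ChainComplex;
  res_projective : forall n, projective (res_complex n);
  res_aug : Hom (res_complex 0%nat) X;
  res_aug_diff : forall x, res_aug (diff res_complex 0 x) = zero;
  res_admissible : admissible (augment res_aug_diff)
}.

(** Cocycles and coboundaries of the complex [Hom (K n) Y], n >= 0. *)
Definition cocycle (K : ChainComplex) Y (n : nat) (f : Hom (K n) Y) : Prop :=
  forall x, f (diff K n x) = zero.

Definition coboundary (K : ChainComplex) Y (n : nat) :
    Hom (K n) Y -> Prop :=
  match n return Hom (K n) Y -> Prop with
  | O => fun f => forall x, f x = zero
  | S m => fun f => exists g : Hom (K m) Y, forall x, f x = g (diff K m x)
  end.

(** The quotient seminorm on Ext^n(X, Y) = cocycles / coboundaries vanishes, i.e.
    the coboundaries are dense in the cocycles; up to topological isomorphism,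
    Ext^n(X, Y) does not depend on the resolution. *)
Definition Ext_topology_trivial (n : nat) X Y : Prop :=
  forall P : ProjectiveResolution X,
  forall f : Hom (P n) Y, cocycle f ->
  forall eps : R, 0 < eps ->
  exists g : Hom (P n) Y,
    coboundary g /\ opnorm (fun x => minus (f x) (g x)) < eps.

Record Z1 X Y := {
  z1_fun :> A -> X -> Y;
  z1_bilinear : is_bilinear z1_fun;
  z1_continuous : jointly_continuous z1_fun;
  z1_cocycle : forall (a b : A) (x : X),
    plus (minus (act a (z1_fun b x)) (z1_fun (alg_mul a b) x))
         (z1_fun a (act b x)) = zero
}.

Definition delta0 X Y (T : BoundedOp X Y) (a : A) (x : X) : Y :=
  minus (act a (T x)) (T (act a x)).

End Modules.

Record DirectedSet := {
  dir_index :> Type;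
  dir_le : dir_index -> dir_index -> Prop;
  dir_refl : forall i, dir_le i i;
  dir_trans : forall i j k, dir_le i j -> dir_le j k -> dir_le i k;
  dir_inhabited : inhabited dir_index;
  dir_directed : forall i j, exists k, dir_le i k /\ dir_le j k
}.

Definition eventually_in (N : DirectedSet) : (N -> Prop) -> Prop :=
  fun Q => exists n0 : N, forall n, dir_le n0 n -> Q n.

Definition converges_in_opnorm (N : DirectedSet) (X Y : BanachSpace)
    (u : N -> X -> Y) (v : X -> Y) : Prop :=
  filterlim (fun n => opnorm (fun x => minus (u n x) (v x)))
    (eventually_in (N := N)) (locally 0).

Definition converges_in_bilnorm (N : DirectedSet) (X Y Z : BanachSpace)
    (u : N -> X -> Y -> Z) (v : X -> Y -> Z) : Prop :=
  filterlim (fun n => bilnorm (fun x y => minus (u n x y) (v x y)))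
    (eventually_in (N := N)) (locally 0).

Definition uniform_approximate_morphism (A : BanachAlgebra)
    (X Y : LeftModule A) (N : DirectedSet) (phi : N -> BoundedOp X Y) : Prop :=
  forall (S : A -> Prop) (T : X -> Prop), bounded_set S -> bounded_set T ->
  forall eps : R, 0 < eps ->
  eventually_in (fun n : N => forall a x, S a -> T x ->
    norm (minus (phi n (act a x)) (act a (phi n x))) < eps).

(* Main.v *)
Require Import Defs.
From Stdlib Require Import Reals Lra Lia List Classical ClassicalEpsilon.
From Stdlib Require Import FunctionalExtensionality PropExtensionality ProofIrrelevance.
From Coquelicot Require Import Coquelicot.

(** The theorem reduces to one module and one cocycle.  Let [K = B(A, I)] with
    the action [(a phi)(b) = phi(b a) - b phi(a)] ([univ_module]).  Evaluation
    [(a, phi) |-> phi(a)] is a 1-cocycle on [K] with values in [I], and it is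
    universal: a cocycle [f] on [X] is the same thing as the morphism
    [X -> K], [x |-> f(-, x)] ([classify]).  Call [I] split ([univ_split]) when
    the universal cocycle is a coboundary [delta0 T] with [T : K -> I] bounded.

    Split implies injective ([univ_split_extension]): extend a morphism
    linearly to [u : X -> I]; the cocycle [delta0 u] is classified by some
    [F : X -> K], and [u - T F] is a morphism.  As [delta0 u] vanishes where
    [u] was already a morphism, so does [F], and the values there are kept.

    The heart of the matter is that an approximate splitting can be made exact
    ([univ_split_of_approx]).  If [delta0 T] is within [c < 1] of the universal
    cocycle, then the morphism [K -> K] that classifies [delta0 T] is within
    [c] of the identity, hence invertible, and composing [T] with its inverse
    gives an exact splitting.  This is where density becomes equality.

    It remains to extract an approximate splitting from each condition.  For
    those about extending morphisms, take the extension
    [0 -> I -> I + K -> K -> 0] that the universal cocycle describes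
    ([ext_module]): an approximate morphism that almost retracts it onto [I]
    restricts on [K] to an approximate splitting
    ([univ_split_of_retraction]).  When the approximate
    morphisms come out of an injective module [J] containing [I], they are
    composed with an extension [I + K -> J] of the embedding [mu].  That the
    maps [delta0 T] come near every cocycle is, for the universal cocycle, an
    approximate splitting as it stands.

    To use the hypothesis on [Ext^1], a projective resolution of [K] is needed.
    Projective tensor products are built as Hausdorff completions of spaces of
    formal sums ([completion], [tensor]); [free_module E = E + A (x) E] is
    projective, and the kernel of [free_module X -> X] is [A (x) X] with a
    twisted action ([syzygy]).  Iterating gives [free_resolution].  Morphisms
    from the first syzygy are 1-cocycles, so density of the coboundaries in the
    complex of the resolution turns into density of the maps [delta0 T]
    ([ext1_trivial_delta0]).  Conversely, for injective [I] a cocycle of any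
    resolution factors linearly through the differential by the contracting
    homotopy, and [univ_split_extension] makes the factor a morphism
    ([injective_ext1_trivial]). *)

Set Implicit Arguments.
Unset Strict Implicit.
Unset Printing Implicit Defensive.

Open Scope R_scope.

(** * Linear identities *)

Section LinearExpressions.

Variable V : ModuleSpace C_Ring.

Inductive lin_expr :=
| LZero
| LAtom (n : nat)
| LPlus (e1 e2 : lin_expr)
| LOpp (e : lin_expr)
| LScal (k : C) (e : lin_expr).

Fixpoint lin_eval (l : list V) (e : lin_expr) : V :=
  match e with
  | LZero => zero
  | LAtom n => nth n l zero
  | LPlus e1 e2 => plus (lin_eval l e1) (lin_eval l e2)
  | LOpp e => opp (lin_eval l e)
  | LScal k e => scal k (lin_eval l e)
  end.

Fixpoint lin_coef (e : lin_expr) (n : nat) : C :=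
  match e with
  | LZero => RtoC 0
  | LAtom m => if Nat.eqb m n then RtoC 1 else RtoC 0
  | LPlus e1 e2 => Cplus (lin_coef e1 n) (lin_coef e2 n)
  | LOpp e => Copp (lin_coef e n)
  | LScal k e => Cmult k (lin_coef e n)
  end.

Fixpoint lin_comb (l : list V) (c : nat -> C) : V :=
  match l with
  | nil => zero
  | x :: l => plus (scal (c 0%nat) x) (lin_comb l (fun n => c (S n)))
  end.

Lemma lin_comb_zero l : lin_comb l (fun _ => RtoC 0) = zero.
Proof.
induction l as [|x l IH]; simpl; [reflexivity|].
rewrite IH, plus_zero_r. exact (scal_zero_l (K := C_Ring) x).
Qed.

Lemma lin_comb_atom l m :
  lin_comb l (fun n => if Nat.eqb m n then RtoC 1 else RtoC 0) = nth m l zero.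
Proof.
revert m; induction l as [|x l IH]; intros [|m]; simpl; try reflexivity.
- rewrite lin_comb_zero, plus_zero_r. exact (scal_one (K := C_Ring) x).
- rewrite IH. transitivity (plus zero (nth m l zero)).
  + f_equal. exact (scal_zero_l (K := C_Ring) x).
  + apply plus_zero_l.
Qed.

Lemma plus_exchange (a b c d : V) :
  plus (plus a b) (plus c d) = plus (plus a c) (plus b d).
Proof.
rewrite <- !plus_assoc; f_equal.
rewrite !plus_assoc; f_equal. apply plus_comm.
Qed.

Lemma lin_comb_plus l c d :
  lin_comb l (fun n => Cplus (c n) (d n)) = plus (lin_comb l c) (lin_comb l d).
Proof.
revert c d; induction l as [|x l IH]; intros c d; simpl.
- now rewrite plus_zero_l.
- rewrite IH, plus_exchange. f_equal.
  exact (scal_distr_r (K := C_Ring) (c 0%nat) (d 0%nat) x).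
Qed.

Lemma lin_comb_scal l k c :
  lin_comb l (fun n => Cmult k (c n)) = scal k (lin_comb l c).
Proof.
revert c; induction l as [|x l IH]; intros c; simpl.
- symmetry; exact (scal_zero_r (K := C_Ring) k).
- rewrite IH, scal_distr_l. f_equal.
  symmetry; exact (scal_assoc (K := C_Ring) k (c 0%nat) x).
Qed.

Lemma lin_comb_opp l c :
  lin_comb l (fun n => Copp (c n)) = opp (lin_comb l c).
Proof.
revert c; induction l as [|x l IH]; intros c; simpl.
- symmetry; exact opp_zero.
- rewrite IH. symmetry. etransitivity; [exact (opp_plus _ _)|]. f_equal.
  symmetry; exact (scal_opp_l (K := C_Ring) (c 0%nat) x).
Qed.

Lemma lin_eval_coef l e : lin_eval l e = lin_comb l (lin_coef e).
Proof.
induction e as [|n|e1 IH1 e2 IH2|e IH|k e IH]; simpl.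
- symmetry; apply lin_comb_zero.
- symmetry; apply lin_comb_atom.
- now rewrite lin_comb_plus, IH1, IH2.
- now rewrite lin_comb_opp, IH.
- now rewrite lin_comb_scal, IH.
Qed.

Fixpoint same_coefs (n : nat) (c d : nat -> C) : Prop :=
  match n with
  | O => True
  | S m => c 0%nat = d 0%nat /\
           same_coefs m (fun i => c (S i)) (fun i => d (S i))
  end.

Lemma lin_eval_eq l e1 e2 :
  same_coefs (length l) (lin_coef e1) (lin_coef e2) ->
  lin_eval l e1 = lin_eval l e2.
Proof.
rewrite !lin_eval_coef.
generalize (lin_coef e1) (lin_coef e2).
induction l as [|x l IH]; intros c d; simpl; [reflexivity|].
intros [H0 H]. f_equal; [now rewrite H0|now apply IH].
Qed.

End LinearExpressions.

Ltac lin_find x l :=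
  lazymatch l with
  | x :: _ => constr:(O)
  | _ :: ?l' => let n := lin_find x l' in constr:(S n)
  end.

Ltac lin_mem x l :=
  lazymatch l with
  | nil => constr:(false)
  | x :: _ => constr:(true)
  | _ :: ?l' => lin_mem x l'
  end.

Ltac lin_atoms e l :=
  lazymatch e with
  | zero => l
  | plus ?a ?b => let l := lin_atoms a l in lin_atoms b l
  | minus ?a ?b => let l := lin_atoms a l in lin_atoms b l
  | opp ?a => lin_atoms a l
  | scal _ ?a => lin_atoms a l
  | _ => let b := lin_mem e l in
         lazymatch b with true => l | false => constr:(e :: l) end
  end.

Ltac lin_reify e l :=
  lazymatch e with
  | zero => constr:(LZero)
  | plus ?a ?b => let a := lin_reify a l in let b := lin_reify b l in
                  constr:(LPlus a b)
  | minus ?a ?b => let a := lin_reify a l in let b := lin_reify b l in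
                   constr:(LPlus a (LOpp b))
  | opp ?a => let a := lin_reify a l in constr:(LOpp a)
  | scal ?k ?a => let a := lin_reify a l in constr:(LScal k a)
  | _ => let n := lin_find e l in constr:(LAtom n)
  end.

(** Decides equalities of linear combinations with complex coefficients, by
    comparing coefficients. *)
Ltac lin_space V :=
  lazymatch goal with
  | |- @eq ?T ?a ?b =>
      let l := lin_atoms a (@nil T) in
      let l := lin_atoms b l in
      let ea := lin_reify a l in
      let eb := lin_reify b l in
      change (@lin_eval V l ea = @lin_eval V l eb);
      apply lin_eval_eq;
      cbn [lin_coef same_coefs length Nat.eqb];
      repeat split; first [reflexivity | ring]
  end.

Ltac lin :=
  lazymatch goal with
  | |- @eq ?T _ _ =>
      let W := open_constr:(_) in
      unify T (CompleteNormedModule.sort C_AbsRing W);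
      lin_space (CompleteNormedModule.ModuleSpace C_AbsRing W)
  end.

(** * Norm estimates *)

Lemma norm_pos (X : BanachSpace) (x : X) : 0 <= norm x.
Proof. exact (@norm_ge_0 C_AbsRing X x). Qed.

Lemma norm_0 (X : BanachSpace) : norm (zero : X) = 0.
Proof. exact (@norm_zero C_AbsRing X). Qed.

Lemma norm_0_eq (X : BanachSpace) (x : X) : norm x = 0 -> x = zero.
Proof. exact (@norm_eq_zero C_AbsRing X x). Qed.

Lemma norm_opp_eq (X : BanachSpace) (x : X) : norm (opp x) = norm x.
Proof. exact (@norm_opp C_AbsRing X x). Qed.

Lemma norm_plus_le (X : BanachSpace) (x y : X) :
  norm (plus x y) <= norm x + norm y.
Proof. exact (@norm_triangle C_AbsRing X x y). Qed.

Lemma norm_le_eq (X : BanachSpace) (x y : X) (c : R) :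
  x = y -> norm y <= c -> norm x <= c.
Proof. now intros ->. Qed.

Lemma norm_lt_eq (X : BanachSpace) (x y : X) (c : R) :
  x = y -> norm y < c -> norm x < c.
Proof. now intros ->. Qed.

(** [replace] would miss occurrences that reach their addition through another
    path of the algebraic hierarchy. *)
Ltac norm_as e :=
  lazymatch goal with
  | |- norm _ <= _ => apply norm_le_eq with (y := e)
  | |- norm _ < _ => apply norm_lt_eq with (y := e)
  end; [try solve [lin]|].

Lemma norm_minus_sym (X : BanachSpace) (x y : X) :
  norm (minus x y) = norm (minus y x).
Proof.
rewrite <- norm_opp_eq. f_equal. lin.
Qed.

Lemma norm_minus_triangle (X : BanachSpace) (x y z : X) :
  norm (minus x z) <= norm (minus x y) + norm (minus y z).
Proof.
norm_as (plus (minus x y) (minus y z)).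
apply norm_plus_le.
Qed.

Lemma norm_minus_le (X : BanachSpace) (x y : X) :
  norm (minus x y) <= norm x + norm y.
Proof.
eapply Rle_trans; [exact (norm_plus_le x (opp y))|].
rewrite norm_opp_eq. apply Rle_refl.
Qed.

Lemma minus_zero_eq (X : BanachSpace) (x y : X) :
  minus x y = zero -> x = y.
Proof.
intros H. transitivity (plus (minus x y) y); [lin|].
rewrite H. lin.
Qed.

Lemma norm_minus_small_eq (X : BanachSpace) (x y : X) :
  (forall eps, 0 < eps -> norm (minus x y) <= eps) -> x = y.
Proof.
intros H. apply minus_zero_eq, norm_0_eq.
apply Rle_antisym; [|apply norm_pos].
apply le_epsilon; intros eps Heps.
rewrite Rplus_0_l. now apply H.
Qed.

Lemma norm_scal_real (X : BanachSpace) (r : R) (x : X) :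
  0 <= r -> norm (scal (RtoC r) x) <= r * norm x.
Proof.
intros Hr. eapply Rle_trans; [apply (@norm_scal C_AbsRing X)|].
change (abs (RtoC r)) with (Cmod (RtoC r)).
rewrite Cmod_R, (Rabs_pos_eq _ Hr). apply Rle_refl.
Qed.

Lemma scal_inv (X : BanachSpace) (r : R) (x : X) :
  r <> 0 -> scal (RtoC r) (scal (RtoC (/ r)) x) = x.
Proof.
intros Hr.
transitivity (scal (RtoC 1) x); [|exact (scal_one (K := C_Ring) x)].
rewrite (scal_assoc (K := C_Ring)). f_equal.
change (Cmult (RtoC r) (RtoC (/ r)) = RtoC 1).
rewrite <- RtoC_mult. f_equal. now apply Rinv_r.
Qed.

Lemma norm_pos_cases (X : BanachSpace) (x : X) : x = zero \/ 0 < norm x.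
Proof.
destruct (norm_pos x) as [H|H]; [now right|left].
now apply norm_0_eq.
Qed.

(** Rescale [x] to norm [r]. The radius is arbitrary because continuity gives
    bounds only on some small ball. *)
Lemma homogeneous_bound (X Y : BanachSpace) (f : X -> Y) (r c : R) :
  0 < r -> 0 <= c ->
  (forall (k : C) x, f (scal k x) = scal k (f x)) ->
  (forall x, norm x <= r -> norm (f x) <= c) ->
  forall x, norm (f x) <= c / r * norm x.
Proof.
intros Hr Hc Hf Hb x.
assert (Hcr : 0 <= c / r) by (apply Rdiv_le_0_compat; lra).
destruct (norm_pos_cases x) as [->|Hx].
- replace (f zero) with (zero : Y).
  + rewrite norm_0. apply Rmult_le_pos; [assumption|apply norm_pos].
  + transitivity (scal (RtoC 0) (f zero)).
    * symmetry; exact (scal_zero_l (K := C_Ring) (f zero)).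
    * rewrite <- Hf. f_equal. exact (scal_zero_l (K := C_Ring) zero).
- set (t := norm x / r).
  assert (Ht : 0 < t) by (apply Rdiv_lt_0_compat; assumption).
  rewrite <- (scal_inv x (Rgt_not_eq _ _ Ht)), Hf.
  eapply Rle_trans; [apply norm_scal_real; lra|].
  apply Rle_trans with (t * c).
  + apply Rmult_le_compat_l; [lra|]. apply Hb.
    eapply Rle_trans; [apply norm_scal_real; left; now apply Rinv_0_lt_compat|].
    right. unfold t; field; lra.
  + rewrite scal_inv by lra. right. unfold t; field; lra.
Qed.

Section BoundedOps.

Variables X Y : BanachSpace.
Implicit Types T : BoundedOp X Y.

Lemma op_plus T x y : T (plus x y) = plus (T x) (T y).
Proof. apply (linear_plus _ (op_linear T)). Qed.

Lemma op_scal T (k : C) x : T (scal k x) = scal k (T x).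
Proof. apply (linear_scal _ (op_linear T)). Qed.

Lemma op_zero T : T zero = zero.
Proof. exact (linear_zero _ (op_linear T)). Qed.

Lemma op_opp T x : T (opp x) = opp (T x).
Proof. exact (linear_opp _ x (op_linear T)). Qed.

Lemma op_minus T x y : T (minus x y) = minus (T x) (T y).
Proof. unfold minus. now rewrite op_plus, op_opp. Qed.

Lemma op_bound T : exists M, 0 < M /\ forall x, norm (T x) <= M * norm x.
Proof. apply (linear_norm _ (op_linear T)). Qed.

Lemma op_ext (S T : BoundedOp X Y) : (forall x, S x = T x) -> S = T.
Proof.
destruct S as [f Hf], T as [g Hg]; simpl; intros H.
assert (f = g) as -> by (apply functional_extensionality; exact H).
now rewrite (proof_irrelevance _ Hf Hg).
Qed.

Lemma mk_linear (f : X -> Y) :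
  (forall x y, f (plus x y) = plus (f x) (f y)) ->
  (forall (k : C) x, f (scal k x) = scal k (f x)) ->
  (exists M, forall x, norm (f x) <= M * norm x) -> is_linear f.
Proof.
intros f_plus f_scal [M HM].
split; [exact f_plus|exact f_scal|].
exists (Rabs M + 1). split.
- pose proof (Rabs_pos M); lra.
- intros x. eapply Rle_trans; [apply HM|].
  apply Rmult_le_compat_r; [apply norm_pos|].
  pose proof (Rle_abs M); lra.
Qed.

End BoundedOps.

Lemma id_linear (X : BanachSpace) : is_linear (fun x : X => x).
Proof.
apply mk_linear; [reflexivity|reflexivity|].
exists 1; intros x; lra.
Qed.

Definition id_op (X : BanachSpace) : BoundedOp X X :=
  {| op_fun := fun x => x; op_linear := id_linear X |}.

Lemma zero_linear (X Y : BanachSpace) : is_linear (fun _ : X => zero : Y).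
Proof.
apply mk_linear.
- intros; lin.
- intros; lin.
- exists 0; intros x. rewrite norm_0; lra.
Qed.

Definition zero_op (X Y : BanachSpace) : BoundedOp X Y :=
  {| op_fun := fun _ => zero; op_linear := zero_linear X Y |}.

Section OpCombinations.

Variables X Y : BanachSpace.
Implicit Types S T : BoundedOp X Y.

Lemma comp_linear (Z : BanachSpace) (S : BoundedOp Y Z) T :
  is_linear (fun x => S (T x)).
Proof.
apply mk_linear.
- intros x y. now rewrite !op_plus.
- intros k x. now rewrite !op_scal.
- destruct (op_bound S) as [M [HM HS]], (op_bound T) as [N [HN HT]].
  exists (M * N); intros x. eapply Rle_trans; [apply HS|].
  rewrite Rmult_assoc. apply Rmult_le_compat_l; [lra|apply HT].
Qed.

Definition comp_op (Z : BanachSpace) (S : BoundedOp Y Z) T : BoundedOp X Z :=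
  {| op_fun := fun x => S (T x); op_linear := comp_linear S T |}.

Lemma plus_linear S T : is_linear (fun x => plus (S x) (T x)).
Proof.
apply mk_linear.
- intros x y. rewrite !op_plus. lin.
- intros k x. rewrite !op_scal. lin.
- destruct (op_bound S) as [M [HM HS]], (op_bound T) as [N [HN HT]].
  exists (M + N); intros x. eapply Rle_trans; [apply norm_plus_le|].
  specialize (HS x); specialize (HT x); lra.
Qed.

Definition plus_op S T : BoundedOp X Y :=
  {| op_fun := fun x => plus (S x) (T x); op_linear := plus_linear S T |}.

Lemma minus_linear S T : is_linear (fun x => minus (S x) (T x)).
Proof.
apply mk_linear.
- intros x y. rewrite !op_plus. lin.
- intros k x. rewrite !op_scal. lin.
- destruct (op_bound S) as [M [HM HS]], (op_bound T) as [N [HN HT]].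
  exists (M + N); intros x. eapply Rle_trans; [apply norm_minus_le|].
  specialize (HS x); specialize (HT x); lra.
Qed.

Definition minus_op S T : BoundedOp X Y :=
  {| op_fun := fun x => minus (S x) (T x); op_linear := minus_linear S T |}.

Lemma scal_linear (k : C) T : is_linear (fun x => scal k (T x)).
Proof.
apply mk_linear.
- intros x y. rewrite !op_plus. lin.
- intros l x. rewrite !op_scal. lin.
- destruct (op_bound T) as [N [HN HT]].
  exists (Cmod k * N); intros x.
  eapply Rle_trans; [apply (@norm_scal C_AbsRing Y)|].
  rewrite Rmult_assoc. apply Rmult_le_compat_l; [apply Cmod_ge_0|apply HT].
Qed.

Definition scal_op (k : C) T : BoundedOp X Y :=
  {| op_fun := fun x => scal k (T x); op_linear := scal_linear k T |}.

End OpCombinations.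

Section Bilinear.

Variables X Y Z : BanachSpace.
Variable f : X -> Y -> Z.
Hypothesis f_bil : is_bilinear f.

Lemma bil_zero_l y : f zero y = zero.
Proof.
transitivity (f (scal (RtoC 0) zero) y).
- f_equal. symmetry. exact (scal_zero_r (K := C_Ring) (RtoC 0)).
- rewrite (bilinear_scal_l f_bil).
  exact (scal_zero_l (K := C_Ring) (f zero y)).
Qed.

Lemma bil_zero_r x : f x zero = zero.
Proof.
transitivity (f x (scal (RtoC 0) zero)).
- f_equal. symmetry. exact (scal_zero_r (K := C_Ring) (RtoC 0)).
- rewrite (bilinear_scal_r f_bil).
  exact (scal_zero_l (K := C_Ring) (f x zero)).
Qed.

Lemma bil_opp_l x y : f (opp x) y = opp (f x y).
Proof.
transitivity (f (scal (Copp (RtoC 1)) x) y).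
- f_equal. lin.
- rewrite (bilinear_scal_l f_bil). lin.
Qed.

Lemma bil_opp_r x y : f x (opp y) = opp (f x y).
Proof.
transitivity (f x (scal (Copp (RtoC 1)) y)).
- f_equal. lin.
- rewrite (bilinear_scal_r f_bil). lin.
Qed.

Lemma bil_minus_l x x' y : f (minus x x') y = minus (f x y) (f x' y).
Proof. unfold minus. now rewrite (bilinear_plus_l f_bil), bil_opp_l. Qed.

Lemma bil_minus_r x y y' : f x (minus y y') = minus (f x y) (f x y').
Proof. unfold minus. now rewrite (bilinear_plus_r f_bil), bil_opp_r. Qed.

(** Continuity at the origin bounds [f] on a small square, and homogeneity in
    each variable spreads the bound. *)
Lemma bilinear_bound :
  jointly_continuous f ->
  exists M, 0 < M /\ forall x y, norm (f x y) <= M * norm x * norm y.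
Proof.
intros Hc.
specialize (Hc (zero, zero)).
destruct (proj1 (filterlim_locally _ _) Hc (mkposreal 1 Rlt_0_1)) as [d Hd].
simpl in Hd.
set (F := @norm_factor C_AbsRing Z).
assert (HF : 0 < F) by apply norm_factor_gt_0.
assert (Hd0 : 0 < d) by apply cond_pos.
assert (Hsmall : forall x y, norm x <= d / 2 -> norm y <= d / 2 ->
  norm (f x y) <= F).
{ intros x y Hx Hy. left.
  assert (Hb : ball (f zero zero) 1 (f x y)).
  { apply (Hd (x, y)). split; simpl; apply (@norm_compat1 C_AbsRing);
      (eapply Rle_lt_trans; [apply norm_minus_le|]);
      rewrite norm_0; lra. }
  apply (@norm_compat2 C_AbsRing Z _ _ (mkposreal 1 Rlt_0_1)) in Hb.
  simpl in Hb. rewrite Rmult_1_r in Hb.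
  replace (f x y) with (minus (f x y) (f zero zero)); [exact Hb|].
  rewrite bil_zero_l. lin. }
exists (F / (d / 2) / (d / 2)). split.
{ repeat apply Rdiv_lt_0_compat; lra. }
intros x y.
assert (Hy : forall x, norm x <= d / 2 -> norm (f x y) <= F / (d / 2) * norm y).
{ intros x0 Hx0. apply (homogeneous_bound (f := f x0)); try lra.
  - intros k y0. apply (bilinear_scal_r f_bil).
  - intros y0. now apply Hsmall. }
assert (HFd : 0 < F / (d / 2)) by (apply Rdiv_lt_0_compat; lra).
eapply Rle_trans.
- apply (homogeneous_bound (f := fun x => f x y) (r := d / 2)
    (c := F / (d / 2) * norm y)); try lra.
  + apply Rmult_le_pos; [lra|apply norm_pos].
  + intros k x0. apply (bilinear_scal_l f_bil).
  + intros x0 Hx0. now apply Hy.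
- right. field. lra.
Qed.

Lemma bilinear_continuous M :
  (forall x y, norm (f x y) <= M * norm x * norm y) ->
  jointly_continuous f.
Proof.
intros HM [x0 y0]. apply filterlim_locally; intros eps; simpl.
set (F := @norm_factor C_AbsRing X).
set (G := @norm_factor C_AbsRing Y).
assert (HF : 0 < F) by apply norm_factor_gt_0.
assert (HG : 0 < G) by apply norm_factor_gt_0.
set (N := Rabs M * (F * G + F * norm y0 + norm x0 * G) + 1).
pose proof (norm_pos x0) as Hx0. pose proof (norm_pos y0) as Hy0.
pose proof (Rabs_pos M) as HMp.
assert (HN : 0 < N).
{ unfold N. assert (0 <= Rabs M * (F * G + F * norm y0 + norm x0 * G));
    [|lra]. apply Rmult_le_pos; [lra|].
  assert (0 < F * G) by now apply Rmult_lt_0_compat.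
  assert (0 <= F * norm y0) by (apply Rmult_le_pos; lra).
  assert (0 <= norm x0 * G) by (apply Rmult_le_pos; lra). lra. }
set (d := Rmin 1 (eps / N)).
assert (Hd : 0 < d).
{ apply Rmin_glb_lt; [lra|]. apply Rdiv_lt_0_compat; [apply cond_pos|lra]. }
assert (Hd1 : d <= 1) by apply Rmin_l.
assert (HdN : d * N <= eps).
{ apply Rle_trans with (eps / N * N).
  - apply Rmult_le_compat_r; [lra|apply Rmin_r].
  - right; field; lra. }
exists (mkposreal d Hd). intros [x y] [Hx Hy]; simpl in Hx, Hy |- *.
apply (@norm_compat2 C_AbsRing X _ _ (mkposreal d Hd)) in Hx.
apply (@norm_compat2 C_AbsRing Y _ _ (mkposreal d Hd)) in Hy.
simpl in Hx, Hy. fold F in Hx. fold G in Hy.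
apply (@norm_compat1 C_AbsRing).
assert (E : minus (f x y) (f x0 y0) =
  plus (f (minus x x0) (minus y y0))
    (plus (f (minus x x0) y0) (f x0 (minus y y0)))).
{ rewrite !bil_minus_r, !bil_minus_l. lin. }
eapply Rle_lt_trans; [apply Req_le, (f_equal norm), E|]; clear E.
assert (HMa : forall u v, norm (f u v) <= Rabs M * (norm u * norm v)).
{ intros u v. eapply Rle_trans; [apply HM|]. rewrite Rmult_assoc.
  apply Rmult_le_compat_r; [|apply Rle_abs].
  apply Rmult_le_pos; apply norm_pos. }
eapply Rle_lt_trans; [apply norm_plus_le|].
eapply Rle_lt_trans; [apply Rplus_le_compat_l, norm_plus_le|].
change (norm (minus x x0) < F * d) in Hx.
change (norm (minus y y0) < G * d) in Hy.
pose proof (HMa (minus x x0) (minus y y0)) as H1.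
pose proof (HMa (minus x x0) y0) as H2.
pose proof (HMa x0 (minus y y0)) as H3.
pose proof (norm_pos (minus x x0)) as Hp.
pose proof (norm_pos (minus y y0)) as Hq.
set (p := norm (minus x x0)) in *. set (q := norm (minus y y0)) in *.
assert (E1 : p * q <= F * G * d).
{ apply Rle_trans with ((F * d) * (G * d)).
  - apply Rmult_le_compat; lra.
  - replace (F * d * (G * d)) with (F * G * d * d) by ring.
    rewrite <- (Rmult_1_r (F * G * d)) at 2.
    apply Rmult_le_compat_l; [|lra].
    apply Rmult_le_pos; [apply Rmult_le_pos|]; lra. }
assert (E2 : p * norm y0 <= F * norm y0 * d).
{ replace (F * norm y0 * d) with (F * d * norm y0) by ring.
  apply Rmult_le_compat_r; lra. }
assert (E3 : norm x0 * q <= norm x0 * G * d).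
{ rewrite Rmult_assoc. apply Rmult_le_compat_l; lra. }
apply Rle_lt_trans with
  (Rabs M * (F * G * d + F * norm y0 * d + norm x0 * G * d)).
- assert (E : Rabs M * (p * q + p * norm y0 + norm x0 * q) <=
     Rabs M * (F * G * d + F * norm y0 * d + norm x0 * G * d)).
  { apply Rmult_le_compat_l; lra. }
  lra.
- apply Rlt_le_trans with (d * N); [|exact HdN].
  replace (Rabs M * (F * G * d + F * norm y0 * d + norm x0 * G * d))
    with (d * (Rabs M * (F * G + F * norm y0 + norm x0 * G))) by ring.
  apply Rmult_lt_compat_l; [exact Hd|]. unfold N; lra.
Qed.

End Bilinear.

(** * Operator and bilinear norms *)

(** [0 <= c] covers the empty set, whose supremum [m_infty] has real part [0]. *)
Lemma Lub_Rbar_le (E : R -> Prop) (c : R) :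
  0 <= c -> (forall r, E r -> r <= c) -> real (Lub_Rbar E) <= c.
Proof.
intros Hc HE. destruct (Lub_Rbar_correct E) as [_ H].
specialize (H (Finite c)).
assert (Hle : Rbar_le (Lub_Rbar E) c) by (apply H; intros r Hr; now apply HE).
destruct (Lub_Rbar E); simpl in *; [exact Hle|contradiction|exact Hc].
Qed.

Lemma Lub_Rbar_ge (E : R -> Prop) (c r : R) :
  (forall r, E r -> r <= c) -> E r -> r <= real (Lub_Rbar E).
Proof.
intros HE Hr. destruct (Lub_Rbar_correct E) as [Hub Hlub].
specialize (Hlub (Finite c) HE). specialize (Hub r Hr).
destruct (Lub_Rbar E); simpl in *; [exact Hub|contradiction|contradiction].
Qed.

Lemma opnorm_le (X Y : BanachSpace) (f : X -> Y) (c : R) :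
  0 <= c -> (forall x, norm x <= 1 -> norm (f x) <= c) -> opnorm f <= c.
Proof.
intros Hc Hf. apply Lub_Rbar_le; [exact Hc|].
intros r [x [Hx ->]]. now apply Hf.
Qed.

Lemma opnorm_ball (X Y : BanachSpace) (T : BoundedOp X Y) x :
  norm x <= 1 -> norm (T x) <= opnorm T.
Proof.
intros Hx. destruct (op_bound T) as [M [HM HT]].
apply Lub_Rbar_ge with (c := M); [|now exists x].
intros r [y [Hy ->]]. eapply Rle_trans; [apply HT|].
rewrite <- (Rmult_1_r M) at 2. apply Rmult_le_compat_l; lra.
Qed.

Lemma opnorm_ge_0 (X Y : BanachSpace) (T : BoundedOp X Y) : 0 <= opnorm T.
Proof.
eapply Rle_trans; [|apply (opnorm_ball T (x := zero)); rewrite norm_0; lra].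
apply norm_pos.
Qed.

Lemma opnorm_bound (X Y : BanachSpace) (T : BoundedOp X Y) x :
  norm (T x) <= opnorm T * norm x.
Proof.
rewrite <- (Rdiv_1_r (opnorm T)).
apply (homogeneous_bound (f := T)).
- lra.
- apply opnorm_ge_0.
- apply op_scal.
- intros y. apply opnorm_ball.
Qed.

(** * Constructing Banach spaces *)

Definition cauchy_seq (V : AbelianGroup) (N : V -> R) (u : nat -> V) : Prop :=
  forall eps, 0 < eps ->
  exists n0, forall n m, (n0 <= n)%nat -> (n0 <= m)%nat ->
  N (minus (u n) (u m)) < eps.

Definition seq_lim (V : AbelianGroup) (N : V -> R) (u : nat -> V) (x : V) : Prop :=
  forall eps, 0 < eps ->
  exists n0, forall n, (n0 <= n)%nat -> N (minus (u n) x) < eps.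

Lemma banach_cauchy_seq (X : BanachSpace) (u : nat -> X) :
  cauchy_seq norm u -> exists x, seq_lim norm u x.
Proof.
intros Hu.
destruct (proj1 (@filterlim_locally_cauchy nat
  (CompleteNormedModule.CompleteSpace C_AbsRing X) eventually _ u)) as [x Hx].
- intros [eps Heps]. destruct (Hu eps Heps) as [n0 Hn].
  exists (fun n => (n0 <= n)%nat). split; [now exists n0|].
  intros n m Hn0 Hm0. apply (@norm_compat1 C_AbsRing X). now apply Hn.
- exists x. intros eps Heps.
  set (F := @norm_factor C_AbsRing X).
  assert (HF : 0 < F) by apply norm_factor_gt_0.
  assert (HeF : 0 < eps / F) by now apply Rdiv_lt_0_compat.
  destruct (proj1 (filterlim_locally _ _) Hx (mkposreal _ HeF)) as [n0 Hn].
  exists n0. intros n Hn0. specialize (Hn n Hn0).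
  apply (@norm_compat2 C_AbsRing X) in Hn. simpl in Hn. fold F in Hn.
  replace (F * (eps / F)) with eps in Hn by (field; lra). exact Hn.
Qed.

(** The balls are those of [N], so that completeness, which the hierarchy asks
    for in terms of filters, can be checked on sequences. *)
Section MakeBanach.

Variable V : ModuleSpace C_Ring.
Variable N : V -> R.
Hypothesis N_plus : forall x y, N (plus x y) <= N x + N y.
Hypothesis N_scal : forall (k : C) x, N (scal k x) <= Cmod k * N x.
Hypothesis N_zero : forall x, N x = 0 -> x = zero.
Hypothesis N_complete : forall u, cauchy_seq N u -> exists x, seq_lim N u x.

Let N_minus_self x : N (minus x x) = 0.
Proof.
assert (H0 : N zero = 0).
{ assert (H : N zero <= 0).
  { pose proof (N_scal (RtoC 0) zero) as H.
    rewrite Cmod_0, Rmult_0_l in H.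
    replace (zero : V) with (scal (RtoC 0) (zero : V)); [exact H|].
    exact (scal_zero_l (K := C_Ring) (zero : V)). }
  pose proof (N_plus zero zero) as H1. rewrite plus_zero_l in H1. lra. }
rewrite <- H0. f_equal. exact (plus_opp_r x).
Qed.

Let N_minus_le x y : N (minus x y) <= N (minus y x).
Proof.
replace (minus x y) with (scal (Copp (RtoC 1)) (minus y x)).
2:{ lin_space V. }
eapply Rle_trans; [apply N_scal|].
rewrite Cmod_opp, Cmod_1. lra.
Qed.

Let N_minus_tri x y z : N (minus x z) <= N (minus x y) + N (minus y z).
Proof.
replace (minus x z) with (plus (minus x y) (minus y z)); [apply N_plus|].
lin_space V.
Qed.

Definition mk_uniform_mixin : UniformSpace.mixin_of V.
Proof.
apply (@UniformSpace.Mixin V zero (fun x e y => N (minus y x) < e)).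
- intros x e. rewrite N_minus_self. apply cond_pos.
- intros x y e H. eapply Rle_lt_trans; [apply N_minus_le|exact H].
- intros x y z e1 e2 H1 H2.
  eapply Rle_lt_trans; [apply (N_minus_tri z y x)|lra].
Defined.

Definition mk_uniform : UniformSpace := UniformSpace.Pack V mk_uniform_mixin V.

(** A Cauchy filter is led to a limit by centres of its balls of radius
    [1 / n]. *)
Lemma mk_filter_limit (F : (mk_uniform -> Prop) -> Prop) :
  exists x : mk_uniform,
    ProperFilter F -> cauchy F -> forall eps : posreal, F (ball x eps).
Proof.
destruct (classic (ProperFilter F /\ cauchy F)) as [[HF HC]|H].
2:{ exists (zero : V). intros H1 H2. exfalso. now apply H. }
assert (Hpos : forall n, 0 < / (INR n + 1)).
{ intros n. apply Rinv_0_lt_compat. pose proof (pos_INR n). lra. }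
assert (Hu : exists u : nat -> V, forall n,
  F (fun y => N (minus y (u n)) < / (INR n + 1))).
{ exists (fun n => proj1_sig (constructive_indefinite_description _
    (HC (mkposreal _ (Hpos n))))).
  intros n. exact (proj2_sig (constructive_indefinite_description _
    (HC (mkposreal _ (Hpos n))))). }
destruct Hu as [u Hu].
assert (Hsmall : forall eps, 0 < eps -> exists n0, forall n, (n0 <= n)%nat ->
  / (INR n + 1) < eps).
{ intros eps Heps.
  destruct (archimed_cor1 eps Heps) as [n0 [H0 Hn0]].
  exists n0. intros n Hn. eapply Rle_lt_trans; [|exact H0].
  apply Rinv_le_contravar.
  - now apply lt_0_INR.
  - apply le_INR in Hn. lra. }
destruct (N_complete (u := u)) as [x Hx].
- intros eps Heps. destruct (Hsmall (eps / 2)) as [n0 Hn0]; [lra|].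
  exists n0. intros n m Hn Hm.
  destruct (filter_ex _ (filter_and _ _ (Hu n) (Hu m))) as [y [Hy1 Hy2]].
  pose proof (N_minus_tri (u n) y (u m)) as H1.
  pose proof (N_minus_le (u n) y) as H2.
  pose proof (Hn0 n Hn). pose proof (Hn0 m Hm). lra.
- exists x. intros _ _ [eps Heps].
  destruct (Hx (eps / 2)) as [n1 Hn1]; [lra|].
  destruct (Hsmall (eps / 2)) as [n2 Hn2]; [lra|].
  set (n := max n1 n2).
  refine (filter_imp _ _ _ (Hu n)). intros y Hy.
  change (N (minus y x) < eps).
  pose proof (N_minus_tri y (u n) x) as H1.
  assert (N (minus (u n) x) < eps / 2) by (apply Hn1; unfold n; lia).
  assert (/ (INR n + 1) < eps / 2) by (apply Hn2; unfold n; lia). lra.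
Qed.

Definition mk_complete_mixin : CompleteSpace.mixin_of mk_uniform.
Proof.
apply (@CompleteSpace.Mixin mk_uniform (fun F =>
  proj1_sig (constructive_indefinite_description _ (mk_filter_limit F)))).
- intros F HF HC eps.
  exact (proj2_sig (constructive_indefinite_description _ (mk_filter_limit F))
    HF HC eps).
- intros F1 F2 H12 H21 eps.
  (* Filters refining each other are equal, hence have the same chosen limit. *)
  assert (F1 = F2) as <-.
  { apply functional_extensionality; intros P.
    apply propositional_extensionality.
    split; [apply H21|apply H12]. }
  apply ball_center.
Defined.

Definition mk_normed_mixin : NormedModule.mixin_of C_AbsRing
  (NormedModuleAux.Pack C_AbsRing V
    (NormedModuleAux.Class C_AbsRing V (ModuleSpace.class C_Ring V)
       mk_uniform_mixin) V).
Proof.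
refine (@NormedModule.Mixin C_AbsRing (NormedModuleAux.Pack C_AbsRing V
    (NormedModuleAux.Class C_AbsRing V (ModuleSpace.class C_Ring V)
       mk_uniform_mixin) V) N 1 _ _ _ _ _).
- exact N_plus.
- exact N_scal.
- intros x y e H. exact H.
- intros x y e H. rewrite Rmult_1_l. exact H.
- exact N_zero.
Defined.

Definition mk_banach : BanachSpace :=
  CompleteNormedModule.Pack C_AbsRing V
    (CompleteNormedModule.Class C_AbsRing V
       (NormedModule.Class C_AbsRing V
          (NormedModuleAux.Class C_AbsRing V (ModuleSpace.class C_Ring V)
             mk_uniform_mixin)
          mk_normed_mixin)
       mk_complete_mixin) V.

End MakeBanach.

(** ** Products *)

Section Product.

Variables X Y : BanachSpace.

Let W : ModuleSpace C_Ring :=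
  prod_ModuleSpace C_Ring (CompleteNormedModule.ModuleSpace C_AbsRing X)
    (CompleteNormedModule.ModuleSpace C_AbsRing Y).

Let NW (p : W) : R := norm (fst p : X) + norm (snd p : Y).

Lemma prod_norm_complete (u : nat -> W) :
  cauchy_seq NW u -> exists x, seq_lim NW u x.
Proof.
intros Hu.
destruct (banach_cauchy_seq (u := fun n => fst (u n) : X)) as [x Hx].
{ intros eps Heps. destruct (Hu eps Heps) as [n0 Hn]. exists n0.
  intros n m Hn0 Hm0. specialize (Hn n m Hn0 Hm0).
  eapply Rle_lt_trans; [|exact Hn].
  rewrite <- (Rplus_0_r (norm _)). apply Rplus_le_compat_l, norm_pos. }
destruct (banach_cauchy_seq (u := fun n => snd (u n) : Y)) as [y Hy].
{ intros eps Heps. destruct (Hu eps Heps) as [n0 Hn]. exists n0.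
  intros n m Hn0 Hm0. specialize (Hn n m Hn0 Hm0).
  eapply Rle_lt_trans; [|exact Hn].
  rewrite <- (Rplus_0_l (norm _)). apply Rplus_le_compat_r, norm_pos. }
exists (x, y). intros eps Heps.
destruct (Hx (eps / 2)) as [n1 H1]; [lra|].
destruct (Hy (eps / 2)) as [n2 H2]; [lra|].
exists (max n1 n2). intros n Hn.
specialize (H1 n ltac:(lia)). specialize (H2 n ltac:(lia)).
replace eps with (eps / 2 + eps / 2) by field.
exact (Rplus_lt_compat _ _ _ _ H1 H2).
Qed.

Definition prod_space : BanachSpace.
Proof.
refine (@mk_banach W NW _ _ _ prod_norm_complete).
- intros [x y] [x' y']. unfold NW.
  apply Rle_trans with ((norm x + norm x') + (norm y + norm y')).
  + apply Rplus_le_compat; apply norm_plus_le.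
  + simpl; lra.
- intros k [x y]. unfold NW. rewrite Rmult_plus_distr_l.
  apply Rplus_le_compat; apply (@norm_scal C_AbsRing).
- intros [x y] H. unfold NW in H; simpl in H.
  pose proof (norm_pos x). pose proof (norm_pos y).
  assert (x = zero) as -> by (apply norm_0_eq; lra).
  assert (y = zero) as -> by (apply norm_0_eq; lra).
  reflexivity.
Defined.

Definition pair_in (x : X) (y : Y) : prod_space := (x, y).
Definition pfst (p : prod_space) : X := fst p.
Definition psnd (p : prod_space) : Y := snd p.

Lemma pair_norm x y : norm (pair_in x y) = norm x + norm y.
Proof. reflexivity. Qed.

Lemma pair_in_plus x y x' y' :
  plus (pair_in x y) (pair_in x' y') = pair_in (plus x x') (plus y y').
Proof. reflexivity. Qed.

Lemma pair_in_scal (k : C) x y :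
  scal k (pair_in x y) = pair_in (scal k x) (scal k y).
Proof. reflexivity. Qed.

Lemma pair_in_eq x x' y y' :
  x = x' -> y = y' -> pair_in x y = pair_in x' y'.
Proof. now intros -> ->. Qed.

Lemma pfst_plus p q : pfst (plus p q) = plus (pfst p) (pfst q).
Proof. reflexivity. Qed.
Lemma psnd_plus p q : psnd (plus p q) = plus (psnd p) (psnd q).
Proof. reflexivity. Qed.
Lemma pfst_scal (k : C) p : pfst (scal k p) = scal k (pfst p).
Proof. reflexivity. Qed.
Lemma psnd_scal (k : C) p : psnd (scal k p) = scal k (psnd p).
Proof. reflexivity. Qed.

Lemma inl_linear :
  is_linear (fun x : X => pair_in x (zero : Y)).
Proof.
apply mk_linear.
- intros x y. rewrite pair_in_plus. apply pair_in_eq; [reflexivity|lin].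
- intros k x. rewrite pair_in_scal. apply pair_in_eq; [reflexivity|lin].
- exists 1. intros x. rewrite pair_norm, norm_0. lra.
Qed.

Definition inl_op : BoundedOp X prod_space :=
  {| op_fun := fun x => pair_in x zero; op_linear := inl_linear |}.

Lemma inr_linear :
  is_linear (fun y : Y => pair_in (zero : X) y).
Proof.
apply mk_linear.
- intros x y. rewrite pair_in_plus. apply pair_in_eq; [lin|reflexivity].
- intros k x. rewrite pair_in_scal. apply pair_in_eq; [lin|reflexivity].
- exists 1. intros x. rewrite pair_norm, norm_0. lra.
Qed.

Definition inr_op : BoundedOp Y prod_space :=
  {| op_fun := fun y => pair_in zero y; op_linear := inr_linear |}.

Lemma fst_linear : is_linear pfst.
Proof.
apply mk_linear; try reflexivity.
exists 1. intros [x y]. rewrite Rmult_1_l.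
change (norm x <= norm x + norm y). pose proof (norm_pos y). lra.
Qed.

Definition fst_op : BoundedOp prod_space X :=
  {| op_fun := pfst; op_linear := fst_linear |}.

Lemma snd_linear : is_linear psnd.
Proof.
apply mk_linear; try reflexivity.
exists 1. intros [x y]. rewrite Rmult_1_l.
change (norm y <= norm x + norm y). pose proof (norm_pos x). lra.
Qed.

Definition snd_op : BoundedOp prod_space Y :=
  {| op_fun := psnd; op_linear := snd_linear |}.

End Product.

(** ** Operators *)

Section Operators.

Variables X Y : BanachSpace.
Implicit Types S T : BoundedOp X Y.

Lemma plus_op_comm S T : plus_op S T = plus_op T S.
Proof. apply op_ext; intros x; simpl; lin. Qed.

Lemma plus_op_assoc S T U : plus_op S (plus_op T U) = plus_op (plus_op S T) U.
Proof. apply op_ext; intros x; simpl; lin. Qed.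

Lemma plus_op_zero S : plus_op S (zero_op X Y) = S.
Proof. apply op_ext; intros x; simpl; lin. Qed.

Definition op_AbelianMonoid : AbelianMonoid :=
  AbelianMonoid.Pack (BoundedOp X Y)
    (AbelianMonoid.Mixin _ _ _ plus_op_comm plus_op_assoc plus_op_zero)
    (BoundedOp X Y).

Lemma plus_op_opp S : plus_op S (scal_op (Copp (RtoC 1)) S) = zero_op X Y.
Proof. apply op_ext; intros x; simpl; lin. Qed.

Definition op_AbelianGroup : AbelianGroup :=
  AbelianGroup.Pack (BoundedOp X Y)
    (AbelianGroup.Class _ (AbelianMonoid.class op_AbelianMonoid)
      (AbelianGroup.Mixin op_AbelianMonoid _ plus_op_opp))
    (BoundedOp X Y).

Lemma scal_op_assoc (k l : C) S :
  scal_op k (scal_op l S) = scal_op (mult (k : C_Ring) l) S.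
Proof.
apply op_ext; intros x. exact (scal_assoc (K := C_Ring) k l (S x)).
Qed.

Lemma scal_op_one S : scal_op (one : C_Ring) S = S.
Proof. apply op_ext; intros x. exact (scal_one (K := C_Ring) (S x)). Qed.

Lemma scal_op_distr_l (k : C) S T :
  scal_op k (plus_op S T) = plus_op (scal_op k S) (scal_op k T).
Proof. apply op_ext; intros x; simpl; lin. Qed.

Lemma scal_op_distr_r (k l : C) S :
  scal_op (plus (k : C_Ring) l) S = plus_op (scal_op k S) (scal_op l S).
Proof.
apply op_ext; intros x. exact (scal_distr_r (K := C_Ring) k l (S x)).
Qed.

Definition op_ModuleSpace : ModuleSpace C_Ring :=
  ModuleSpace.Pack C_Ring (BoundedOp X Y)
    (ModuleSpace.Class C_Ring _ (AbelianGroup.class op_AbelianGroup)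
      (ModuleSpace.Mixin C_Ring op_AbelianGroup _ scal_op_assoc scal_op_one
         scal_op_distr_l scal_op_distr_r))
    (BoundedOp X Y).

Definition op_norm (T : op_ModuleSpace) : R := opnorm (T : BoundedOp X Y).

(** The pointwise limit [g] is approached uniformly on the unit ball, and the
    uniform estimate carries linearity and boundedness over to it. *)
Lemma op_norm_complete (u : nat -> op_ModuleSpace) :
  cauchy_seq op_norm u -> exists x, seq_lim op_norm u x.
Proof.
intros Hu.
assert (Happ : forall n m x,
  norm (minus ((u n : BoundedOp X Y) x) ((u m : BoundedOp X Y) x)) <=
    op_norm (minus (u n) (u m)) * norm x).
{ intros n m x.
  norm_as ((minus (u n) (u m) : BoundedOp X Y) x).
  - simpl. lin.
  - apply opnorm_bound. }
assert (Hlim : forall x : X, exists y, seq_lim norm (fun n => (u n : BoundedOp X Y) x) y).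
{ intros x. apply banach_cauchy_seq. intros eps Heps.
  pose proof (norm_pos x) as Hx.
  destruct (Hu (eps / (norm x + 1))) as [n0 Hn].
  { apply Rdiv_lt_0_compat; lra. }
  exists n0. intros n m Hn0 Hm0. specialize (Hn n m Hn0 Hm0).
  eapply Rle_lt_trans; [apply Happ|].
  apply Rle_lt_trans with (eps / (norm x + 1) * norm x).
  - apply Rmult_le_compat_r; lra.
  - apply Rlt_le_trans with (eps / (norm x + 1) * (norm x + 1)).
    + apply Rmult_lt_compat_l; [apply Rdiv_lt_0_compat|]; lra.
    + right; field; lra. }
set (g := fun x => proj1_sig (constructive_indefinite_description _ (Hlim x))).
assert (Hg : forall x, seq_lim norm (fun n => (u n : BoundedOp X Y) x) (g x)).
{ intros x. exact (proj2_sig (constructive_indefinite_description _ (Hlim x))). }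
assert (Hunif : forall eps, 0 < eps -> exists n0, forall n x, (n0 <= n)%nat ->
  norm (minus ((u n : BoundedOp X Y) x) (g x)) <= eps * norm x).
{ intros eps Heps. destruct (Hu eps Heps) as [n0 Hn]. exists n0.
  intros n x Hn0. apply le_epsilon; intros e He.
  destruct (Hg x e He) as [n1 Hn1].
  set (m := max n0 n1).
  eapply Rle_trans; [apply (norm_minus_triangle _ ((u m : BoundedOp X Y) x))|].
  apply Rplus_le_compat.
  - eapply Rle_trans; [apply Happ|].
    apply Rmult_le_compat_r; [apply norm_pos|].
    left; apply Hn; unfold m; lia.
  - left; apply Hn1; unfold m; lia. }
assert (Hgp : forall x y, g (plus x y) = plus (g x) (g y)).
{ intros x y. apply norm_minus_small_eq. intros eps Heps.
  set (M := norm (plus x y) + norm x + norm y + 1).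
  assert (HM : 0 < M).
  { unfold M. pose proof (norm_pos (plus x y)). pose proof (norm_pos x).
    pose proof (norm_pos y). lra. }
  assert (Hd : 0 < eps / M) by now apply Rdiv_lt_0_compat.
  destruct (Hunif _ Hd) as [n Hn].
  pose proof (Hn n (plus x y) (Nat.le_refl n)) as H1.
  pose proof (Hn n x (Nat.le_refl n)) as H2.
  pose proof (Hn n y (Nat.le_refl n)) as H3.
  rewrite op_plus in H1.
  set (a := (u n : BoundedOp X Y) x) in *. set (b := (u n : BoundedOp X Y) y) in *.
  norm_as (minus (plus (minus a (g x)) (minus b (g y)))
       (minus (plus a b) (g (plus x y)))).
  eapply Rle_trans; [apply norm_minus_le|].
  pose proof (norm_plus_le (minus a (g x)) (minus b (g y))) as H4.
  apply Rle_trans with (eps / M * (M - 1)).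
  - replace (M - 1) with (norm x + norm y + norm (plus x y))
      by (unfold M; ring).
    rewrite !Rmult_plus_distr_l.
    apply Rplus_le_compat; [|exact H1].
    eapply Rle_trans; [exact H4|]. now apply Rplus_le_compat.
  - apply Rle_trans with (eps / M * M); [|right; field; lra].
    apply Rmult_le_compat_l; lra. }
assert (Hgs : forall (k : C) x, g (scal k x) = scal k (g x)).
{ intros k x. apply norm_minus_small_eq. intros eps Heps.
  set (M := norm (scal k x) + Cmod k * norm x + 1).
  assert (HM : 0 < M).
  { unfold M. pose proof (norm_pos (scal k x)).
    assert (0 <= Cmod k * norm x)
      by (apply Rmult_le_pos; [apply Cmod_ge_0|apply norm_pos]). lra. }
  assert (Hd : 0 < eps / M) by now apply Rdiv_lt_0_compat.
  destruct (Hunif _ Hd) as [n Hn].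
  pose proof (Hn n (scal k x) (Nat.le_refl n)) as H1.
  pose proof (Hn n x (Nat.le_refl n)) as H2.
  rewrite op_scal in H1.
  set (a := (u n : BoundedOp X Y) x) in *.
  norm_as (minus (scal k (minus a (g x))) (minus (scal k a) (g (scal k x)))).
  eapply Rle_trans; [apply norm_minus_le|].
  pose proof (@norm_scal C_AbsRing Y k (minus a (g x))) as H4.
  change (abs k) with (Cmod k) in H4.
  assert (H5 : Cmod k * norm (minus a (g x)) <= Cmod k * (eps / M * norm x)).
  { apply Rmult_le_compat_l; [apply Cmod_ge_0|exact H2]. }
  apply Rle_trans with (eps / M * (M - 1)).
  - replace (M - 1) with (Cmod k * norm x + norm (scal k x))
      by (unfold M; ring).
    rewrite Rmult_plus_distr_l.
    apply Rplus_le_compat; [|exact H1].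
    eapply Rle_trans; [exact H4|]. eapply Rle_trans; [exact H5|].
    right; ring.
  - apply Rle_trans with (eps / M * M); [|right; field; lra].
    apply Rmult_le_compat_l; lra. }
assert (Hgb : exists M, forall x, norm (g x) <= M * norm x).
{ destruct (Hunif 1 Rlt_0_1) as [n Hn].
  destruct (op_bound (u n)) as [M [HM HT]].
  exists (1 + M). intros x. specialize (Hn n x (Nat.le_refl n)). specialize (HT x).
  norm_as (minus ((u n : BoundedOp X Y) x)
    (minus ((u n : BoundedOp X Y) x) (g x))).
  eapply Rle_trans; [apply norm_minus_le|]. lra. }
exists {| op_fun := g; op_linear := mk_linear Hgp Hgs Hgb |}. intros eps Heps.
destruct (Hunif (eps / 2)) as [n0 Hn]; [lra|].
exists n0. intros n Hn0. apply Rle_lt_trans with (eps / 2); [|lra].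
apply opnorm_le; [lra|]. intros x Hx.
eapply Rle_trans; [|apply Rle_trans with (eps / 2 * norm x)].
- apply Req_le. apply (f_equal norm).
  transitivity (minus ((u n : BoundedOp X Y) x) (g x)); [|reflexivity].
  simpl. lin.
- now apply Hn.
- rewrite <- (Rmult_1_r (eps / 2)) at 2. apply Rmult_le_compat_l; lra.
Qed.

Definition op_space : BanachSpace.
Proof.
refine (@mk_banach op_ModuleSpace op_norm _ _ _ op_norm_complete).
- intros S T. apply opnorm_le.
  + apply Rplus_le_le_0_compat; apply opnorm_ge_0.
  + intros x Hx. eapply Rle_trans; [apply (norm_plus_le (S x) (T x))|].
    apply Rplus_le_compat; now apply opnorm_ball.
- intros k T. apply opnorm_le.
  + apply Rmult_le_pos; [apply Cmod_ge_0|apply opnorm_ge_0].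
  + intros x Hx. eapply Rle_trans; [apply (@norm_scal C_AbsRing Y k (T x))|].
    apply Rmult_le_compat_l; [apply Cmod_ge_0|now apply opnorm_ball].
- intros T HT. apply op_ext. intros x. apply norm_0_eq.
  apply Rle_antisym; [|apply norm_pos].
  eapply Rle_trans; [apply opnorm_bound|].
  unfold op_norm in HT. rewrite HT. lra.
Defined.

Definition op_out (T : op_space) : BoundedOp X Y := T.

End Operators.

Lemma bilinear_unit_bound (X Y Z : BanachSpace) (f : X -> Y -> Z) (c : R) :
  is_bilinear f -> 0 <= c ->
  (forall x y, norm x <= 1 -> norm y <= 1 -> norm (f x y) <= c) ->
  forall x y, norm (f x y) <= c * norm x * norm y.
Proof.
intros Hf Hc H x y.
assert (Hy : forall x, norm x <= 1 -> norm (f x y) <= c * norm y).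
{ intros x0 Hx0. rewrite <- (Rdiv_1_r c).
  apply (homogeneous_bound (f := f x0)); try lra.
  - intros k y0. apply (bilinear_scal_r Hf).
  - intros y0. now apply H. }
replace (c * norm x * norm y) with (c * norm y / 1 * norm x) by field.
apply (homogeneous_bound (f := fun x => f x y)).
- lra.
- apply Rmult_le_pos; [exact Hc|apply norm_pos].
- intros k x0. apply (bilinear_scal_l Hf).
- exact Hy.
Qed.

Lemma bilnorm_le (X Y Z : BanachSpace) (f : X -> Y -> Z) (c : R) :
  0 <= c ->
  (forall x y, norm x <= 1 -> norm y <= 1 -> norm (f x y) <= c) ->
  bilnorm f <= c.
Proof.
intros Hc H. apply Lub_Rbar_le; [exact Hc|].
intros r (x & y & Hx & Hy & ->). now apply H.
Qed.

Lemma bilnorm_bound (X Y Z : BanachSpace) (f : X -> Y -> Z) :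
  is_bilinear f -> jointly_continuous f ->
  forall x y, norm (f x y) <= bilnorm f * norm x * norm y.
Proof.
intros Hf Hc. destruct (bilinear_bound Hf Hc) as [M [HM Hb]].
assert (H : forall x y, norm x <= 1 -> norm y <= 1 -> norm (f x y) <= M).
{ intros x y Hx Hy. eapply Rle_trans; [apply Hb|].
  replace M with (M * 1 * 1) at 2 by ring.
  apply Rmult_le_compat; try apply norm_pos; try lra.
  - apply Rmult_le_pos; [lra|apply norm_pos].
  - apply Rmult_le_compat_l; lra. }
assert (H1 : forall x y, norm x <= 1 -> norm y <= 1 -> norm (f x y) <= bilnorm f).
{ intros x y Hx Hy. apply Lub_Rbar_ge with (c := M).
  - intros r (x' & y' & Hx' & Hy' & ->). now apply H.
  - now exists x, y. }
apply bilinear_unit_bound; [exact Hf| |exact H1].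
eapply Rle_trans; [apply norm_pos|apply (H1 zero zero)]; rewrite norm_0; lra.
Qed.

(** * Perturbations of the identity *)

Lemma small_error (c K : R) :
  0 <= c < 1 -> 0 <= K -> forall eps, 0 < eps ->
  exists n0, forall n, (n0 <= n)%nat -> c ^ n * K < eps.
Proof.
intros Hc HK eps Heps.
destruct (pow_lt_1_zero c) with (y := eps / (K + 1)) as [n0 Hn0].
- rewrite Rabs_pos_eq; lra.
- apply Rdiv_lt_0_compat; lra.
- exists n0. intros n Hn. specialize (Hn0 n Hn).
  rewrite Rabs_pos_eq in Hn0 by (apply pow_le; lra).
  apply Rle_lt_trans with (eps / (K + 1) * K).
  + apply Rmult_le_compat_r; lra.
  + apply Rlt_le_trans with (eps / (K + 1) * (K + 1)); [|right; field; lra].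
    apply Rmult_lt_compat_l; [apply Rdiv_lt_0_compat|]; lra.
Qed.

(** The partial sums of the Neumann series are produced by repeatedly adding
    the residual [y - U x]; since [U] is bounded below by [1 - c], the
    geometric decay of the residuals makes them a Cauchy sequence. *)
Lemma near_identity_invertible (X : BanachSpace) (U : BoundedOp X X) (c : R) :
  0 <= c < 1 ->
  (forall x, norm (minus (U x) x) <= c * norm x) ->
  exists S : BoundedOp X X, (forall x, U (S x) = x) /\ (forall x, S (U x) = x).
Proof.
intros Hc HU.
assert (Hlow : forall x, (1 - c) * norm x <= norm (U x)).
{ intros x. assert (norm x <= norm (U x) + norm (minus (U x) x)).
  { norm_as (minus (U x) (minus (U x) x)). apply norm_minus_le. }
  specialize (HU x). lra. }
assert (Hlow2 : forall x y, norm (minus x y) <= / (1 - c) * norm (minus (U x) (U y))).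
{ intros x y. apply Rmult_le_reg_l with (1 - c); [lra|].
  rewrite <- Rmult_assoc, Rinv_r, Rmult_1_l by lra.
  eapply Rle_trans; [apply Hlow|]. apply Req_le, (f_equal norm), op_minus. }
assert (Hinj : forall x y, U x = U y -> x = y).
{ intros x y H. apply norm_minus_small_eq. intros eps Heps.
  eapply Rle_trans; [apply Hlow2|]. rewrite H.
  apply Rle_trans with (/ (1 - c) * 0); [|lra].
  apply Rmult_le_compat_l; [left; apply Rinv_0_lt_compat; lra|].
  norm_as (zero : X). rewrite norm_0; lra. }
assert (Hsur : forall y, exists x, U x = y).
{ intros y.
  set (u := fix u n := match n with
     | O => zero
     | S m => plus (u m) (minus y (U (u m))) end : X).
  assert (Hres : forall n, norm (minus y (U (u n))) <= c ^ n * norm y).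
  { induction n as [|n IH].
    - simpl. rewrite op_zero. norm_as y. lra.
    - simpl u. rewrite op_plus. set (r := minus y (U (u n))) in *.
      norm_as (opp (minus (U r) r)).
      + unfold r; lin.
      + rewrite norm_opp_eq. eapply Rle_trans; [apply HU|]. simpl.
        rewrite Rmult_assoc. apply Rmult_le_compat_l; lra. }
  assert (Hic : 0 < / (1 - c)) by (apply Rinv_0_lt_compat; lra).
  destruct (banach_cauchy_seq (u := u)) as [x Hx].
  { intros eps Heps.
    destruct (small_error Hc (norm_pos y) (eps := (1 - c) * (eps / 2)))
      as [n0 Hn0].
    { apply Rmult_lt_0_compat; lra. }
    exists n0. intros n m Hn Hm.
    eapply Rle_lt_trans; [apply Hlow2|].
    apply Rmult_lt_reg_l with (1 - c); [lra|].
    rewrite <- Rmult_assoc, Rinv_r, Rmult_1_l by lra.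
    norm_as (minus (minus y (U (u m))) (minus y (U (u n)))).
    eapply Rle_lt_trans; [apply norm_minus_le|].
    pose proof (Hres n); pose proof (Hres m).
    pose proof (Hn0 n Hn); pose proof (Hn0 m Hm). lra. }
  exists x. apply norm_minus_small_eq. intros eps Heps.
  destruct (op_bound U) as [M [HM HUM]].
  destruct (Hx (eps / 2 / M)) as [n1 Hn1].
  { apply Rdiv_lt_0_compat; lra. }
  destruct (small_error Hc (norm_pos y) (eps := eps / 2)) as [n2 Hn2]; [lra|].
  set (n := max n1 n2).
  specialize (Hn1 n ltac:(lia)). specialize (Hn2 n ltac:(lia)).
  norm_as (opp (plus (minus (U (u n)) (U x)) (minus y (U (u n))))).
  rewrite norm_opp_eq.
  eapply Rle_trans; [apply norm_plus_le|].
  replace eps with (eps / 2 + eps / 2) by field.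
  apply Rplus_le_compat.
  - apply norm_le_eq with (y := U (minus (u n) x)).
    + now rewrite op_minus.
    + eapply Rle_trans; [apply HUM|].
      apply Rle_trans with (M * (eps / 2 / M)).
      * apply Rmult_le_compat_l; [lra|left; exact Hn1].
      * right; field; lra.
  - eapply Rle_trans; [apply Hres|]. left; exact Hn2. }
set (g := fun y => proj1_sig (constructive_indefinite_description _ (Hsur y))).
assert (Hg : forall y, U (g y) = y).
{ intros y. exact (proj2_sig (constructive_indefinite_description _ (Hsur y))). }
assert (Hlin : is_linear g).
{ apply mk_linear.
  - intros x y. apply Hinj. now rewrite op_plus, !Hg.
  - intros k x. apply Hinj. now rewrite op_scal, !Hg.
  - exists (/ (1 - c)). intros y.
    apply Rmult_le_reg_l with (1 - c); [lra|].
    rewrite <- Rmult_assoc, Rinv_r, Rmult_1_l by lra.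
    eapply Rle_trans; [apply Hlow|]. rewrite Hg. lra. }
exists {| op_fun := g; op_linear := Hlin |}. split; simpl.
- exact Hg.
- intros x. apply Hinj. now rewrite Hg.
Qed.

(** * Modules *)

Section ModuleBasics.

Variable A : BanachAlgebra.
Implicit Types X Y I : LeftModule A.

Lemma act_bound X :
  exists M, 0 < M /\ forall (a : A) (x : X), norm (act a x) <= M * norm a * norm x.
Proof.
exact (bilinear_bound (@act_bilinear A X) (@act_continuous A X)).
Qed.

Lemma act_plus X (a : A) (x y : X) : act a (plus x y) = plus (act a x) (act a y).
Proof. apply (bilinear_plus_r (@act_bilinear A X)). Qed.
Lemma act_scal X (k : C) (a : A) (x : X) : act a (scal k x) = scal k (act a x).
Proof. apply (bilinear_scal_r (@act_bilinear A X)). Qed.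
Lemma act_minus X (a : A) (x y : X) :
  act a (minus x y) = minus (act a x) (act a y).
Proof. apply (bil_minus_r (@act_bilinear A X)). Qed.
Lemma act_zero X (a : A) : act a (zero : X) = zero.
Proof. apply (bil_zero_r (@act_bilinear A X)). Qed.

Lemma z1_bound X Y (f : Z1 X Y) :
  exists M, 0 < M /\ forall (a : A) (x : X), norm (f a x) <= M * norm a * norm x.
Proof. exact (bilinear_bound (@z1_bilinear A X Y f) (@z1_continuous A X Y f)). Qed.

Lemma z1_eq X Y (f : Z1 X Y) (a b : A) (x : X) :
  f (alg_mul a b) x = plus (act a (f b x)) (f a (act b x)).
Proof.
pose proof (z1_cocycle f a b x) as H.
transitivity (minus (plus (act a (f b x)) (f a (act b x)))
  (plus (minus (act a (f b x)) (f (alg_mul a b) x)) (f a (act b x)))); [lin|].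
rewrite H. lin.
Qed.

Section Coboundary.

Variables X Y : LeftModule A.
Variable T : BoundedOp X Y.

Lemma delta0_bilinear : is_bilinear (delta0 T).
Proof.
split; intros; unfold delta0.
- rewrite !(bilinear_plus_l (@act_bilinear A _)), op_plus. lin.
- rewrite !(bilinear_scal_l (@act_bilinear A _)), op_scal. lin.
- rewrite op_plus, !act_plus, op_plus. lin.
- rewrite op_scal, !act_scal, op_scal. lin.
Qed.

Lemma delta0_bound :
  exists M, forall a x, norm (delta0 T a x) <= M * norm a * norm x.
Proof.
destruct (op_bound T) as [M [HM HT]], (act_bound X) as [N [HN HX]],
  (act_bound Y) as [P [HP HY]].
exists (P * M + M * N). intros a x. unfold delta0.
eapply Rle_trans; [apply norm_minus_le|].
replace ((P * M + M * N) * norm a * norm x) with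
  (P * norm a * (M * norm x) + M * (N * norm a * norm x)) by ring.
apply Rplus_le_compat.
- eapply Rle_trans; [apply HY|]. apply Rmult_le_compat_l; [|apply HT].
  apply Rmult_le_pos; [lra|apply norm_pos].
- eapply Rle_trans; [apply HT|]. apply Rmult_le_compat_l; [lra|apply HX].
Qed.

Lemma delta0_continuous : jointly_continuous (delta0 T).
Proof.
destruct delta0_bound as [M HM].
exact (bilinear_continuous delta0_bilinear HM).
Qed.

Lemma delta0_cocycle (a b : A) (x : X) :
  plus (minus (act a (delta0 T b x)) (delta0 T (alg_mul a b) x))
       (delta0 T a (act b x)) = zero.
Proof. unfold delta0. rewrite act_minus, !act_assoc. lin. Qed.

Definition delta0_z1 : Z1 X Y :=
  {| z1_fun := delta0 T; z1_bilinear := delta0_bilinear;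
     z1_continuous := delta0_continuous; z1_cocycle := delta0_cocycle |}.

End Coboundary.

End ModuleBasics.

Section MakeModule.

Variable A : BanachAlgebra.
Variable V : BanachSpace.
Variable f : A -> V -> V.
Hypothesis f_bil : is_bilinear f.
Hypothesis f_bound : exists M, forall a x, norm (f a x) <= M * norm a * norm x.
Hypothesis f_assoc : forall a b x, f (alg_mul a b) x = f a (f b x).

Lemma mk_module_continuous : jointly_continuous f.
Proof.
destruct f_bound as [M HM]. exact (bilinear_continuous f_bil HM).
Qed.

Definition mk_module : LeftModule A :=
  {| mod_space := V; act := f; act_bilinear := f_bil;
     act_continuous := mk_module_continuous; act_assoc := f_assoc |}.

End MakeModule.

(** * The universal cocycle *)

Section Universal.

Variable A : BanachAlgebra.
Variable I : LeftModule A.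

Section Action.

Variable a : A.
Variable phi : BoundedOp A I.

Definition univ_act_fun (b : A) : I :=
  minus (phi (alg_mul b a)) (act b (phi a)).

Lemma univ_act_linear : is_linear univ_act_fun.
Proof.
apply mk_linear; unfold univ_act_fun.
- intros b c. rewrite (bilinear_plus_l (@alg_mul_bilinear A)), op_plus.
  rewrite (bilinear_plus_l (@act_bilinear A I)). lin.
- intros k b. rewrite (bilinear_scal_l (@alg_mul_bilinear A)), op_scal.
  rewrite (bilinear_scal_l (@act_bilinear A I)). lin.
- destruct (act_bound I) as [N [HN HI]].
  exists (opnorm phi * norm a + N * (opnorm phi * norm a)). intros b.
  eapply Rle_trans; [apply norm_minus_le|].
  rewrite Rmult_plus_distr_r. apply Rplus_le_compat.
  + eapply Rle_trans; [apply opnorm_bound|].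
    rewrite Rmult_assoc. apply Rmult_le_compat_l; [apply opnorm_ge_0|].
    rewrite Rmult_comm. apply alg_mul_norm.
  + eapply Rle_trans; [apply HI|].
    replace (N * (opnorm phi * norm a) * norm b) with
      (N * norm b * (opnorm phi * norm a)) by ring.
    apply Rmult_le_compat_l; [|apply opnorm_bound].
    apply Rmult_le_pos; [lra|apply norm_pos].
Qed.

Definition univ_act : BoundedOp A I :=
  {| op_fun := univ_act_fun; op_linear := univ_act_linear |}.

End Action.

Lemma univ_act_bilinear :
  is_bilinear (univ_act : A -> op_space A I -> op_space A I).
Proof.
split; intros; apply op_ext; intros b; simpl; unfold univ_act_fun; simpl.
- rewrite (bilinear_plus_r (@alg_mul_bilinear A)), !op_plus, act_plus. lin.
- rewrite (bilinear_scal_r (@alg_mul_bilinear A)), !op_scal, act_scal. lin.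
- rewrite act_plus. lin.
- rewrite act_scal. lin.
Qed.

Lemma univ_act_bound : exists M, forall (a : A) (phi : op_space A I),
  norm (univ_act a phi : op_space A I) <= M * norm a * norm phi.
Proof.
destruct (act_bound I) as [N [HN HI]].
exists (1 + N). intros a phi.
assert (Hpos : 0 <= opnorm (op_out phi) * norm a).
{ apply Rmult_le_pos; [apply opnorm_ge_0|apply norm_pos]. }
change (opnorm (univ_act a phi) <= (1 + N) * norm a * opnorm (op_out phi)).
replace ((1 + N) * norm a * opnorm (op_out phi)) with
  ((1 + N) * (opnorm (op_out phi) * norm a)) by ring.
apply opnorm_le.
- apply Rmult_le_pos; lra.
- intros b Hb. simpl. unfold univ_act_fun.
  eapply Rle_trans; [apply norm_minus_le|].
  rewrite Rmult_plus_distr_r, Rmult_1_l. apply Rplus_le_compat.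
  + eapply Rle_trans; [apply opnorm_bound|].
    apply Rmult_le_compat_l; [apply opnorm_ge_0|].
    eapply Rle_trans; [apply alg_mul_norm|].
    rewrite <- (Rmult_1_l (norm a)) at 2.
    apply Rmult_le_compat_r; [apply norm_pos|exact Hb].
  + eapply Rle_trans; [apply HI|].
    rewrite Rmult_assoc. apply Rmult_le_compat_l; [lra|].
    rewrite <- (Rmult_1_l (opnorm _ * _)).
    apply Rmult_le_compat; try apply norm_pos; [exact Hb|apply opnorm_bound].
Qed.

Lemma univ_act_assoc (a b : A) (phi : BoundedOp A I) :
  univ_act (alg_mul a b) phi = univ_act a (univ_act b phi).
Proof.
apply op_ext; intros c; simpl; unfold univ_act_fun; simpl; unfold univ_act_fun.
rewrite alg_mul_assoc, act_minus, <- act_assoc. lin.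
Qed.

(** [B(A, I)], with the action making evaluation a cocycle. It is the quotient of
    the cofree module [B(A_+, I)] by the copy of [I] that the orbit maps form. *)
Definition univ_module : LeftModule A :=
  @mk_module A (op_space A I) univ_act univ_act_bilinear univ_act_bound
    univ_act_assoc.

Definition univ_eval (a : A) (phi : univ_module) : I :=
  op_out (phi : op_space A I) a.

Lemma univ_eval_norm a phi : norm (univ_eval a phi) <= norm a * norm phi.
Proof.
rewrite Rmult_comm.
exact (opnorm_bound (op_out (phi : op_space A I)) a).
Qed.

Lemma univ_eval_bilinear : is_bilinear univ_eval.
Proof.
split; intros; unfold univ_eval; try reflexivity.
- apply op_plus.
- apply op_scal.
Qed.

Lemma univ_eval_continuous : jointly_continuous univ_eval.
Proof.
apply (bilinear_continuous univ_eval_bilinear (M := 1)).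
intros a phi. rewrite Rmult_1_l. apply univ_eval_norm.
Qed.

Lemma univ_eval_act (a b : A) (phi : univ_module) :
  univ_eval a (act b phi) =
  minus (univ_eval (alg_mul a b) phi) (act a (univ_eval b phi)).
Proof. reflexivity. Qed.

Lemma univ_eval_cocycle (a b : A) (phi : univ_module) :
  plus (minus (act a (univ_eval b phi)) (univ_eval (alg_mul a b) phi))
       (univ_eval a (act b phi)) = zero.
Proof. rewrite univ_eval_act. lin. Qed.

Definition univ_cocycle : Z1 univ_module I :=
  {| z1_fun := univ_eval; z1_bilinear := univ_eval_bilinear;
     z1_continuous := univ_eval_continuous; z1_cocycle := univ_eval_cocycle |}.

Lemma univ_ext (phi psi : univ_module) :
  (forall a, univ_eval a phi = univ_eval a psi) -> phi = psi.
Proof. exact (@op_ext A I phi psi). Qed.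

(** ** Classifying morphisms *)

Section Classify.

Variable X : LeftModule A.
Variable f : Z1 X I.

Lemma classify_linear x : is_linear (fun a : A => f a x).
Proof.
apply mk_linear.
- intros a b. apply (bilinear_plus_l (@z1_bilinear A X I f)).
- intros k a. apply (bilinear_scal_l (@z1_bilinear A X I f)).
- destruct (z1_bound f) as [M [HM Hf]].
  exists (M * norm x). intros a. eapply Rle_trans; [apply Hf|]. right; ring.
Qed.

Definition classify_fun (x : X) : univ_module :=
  {| op_fun := fun a : A => f a x; op_linear := classify_linear x |}.

Lemma classify_fun_linear : is_linear classify_fun.
Proof.
apply mk_linear.
- intros x y. apply univ_ext. intros a.
  exact (bilinear_plus_r (@z1_bilinear A X I f) a x y).
- intros k x. apply univ_ext. intros a.
  exact (bilinear_scal_r (@z1_bilinear A X I f) k a x).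
- destruct (z1_bound f) as [M [HM Hf]].
  exists M. intros x. apply opnorm_le.
  + apply Rmult_le_pos; [lra|apply norm_pos].
  + intros a Ha. eapply Rle_trans; [apply Hf|].
    apply Rmult_le_compat_r; [apply norm_pos|].
    rewrite <- (Rmult_1_r M) at 2. apply Rmult_le_compat_l; lra.
Qed.

Definition classify_op : BoundedOp X univ_module :=
  {| op_fun := classify_fun; op_linear := classify_fun_linear |}.

Lemma classify_act (a : A) (x : X) :
  classify_op (act a x) = act a (classify_op x).
Proof.
apply univ_ext. intros b. rewrite univ_eval_act.
change (f b (act a x) = minus (f (alg_mul b a) x) (act b (f a x))).
rewrite z1_eq. lin.
Qed.

(** The cocycle identity of [f] is exactly equivariance of [x |-> f(-, x)] for
    the action on [univ_module]. *)
Definition classify : Hom X univ_module :=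
  {| hom_op := classify_op; hom_act := classify_act |}.

End Classify.

(** By universality, every cocycle with values in [I] is then a coboundary, by
    an operator that factors through its classifying morphism. *)
Definition univ_split : Prop :=
  exists T : BoundedOp univ_module I, forall a phi,
    delta0 T a phi = univ_eval a phi.

(** An operator [T] whose coboundary is near the universal cocycle classifies
    a near-identity endomorphism of [univ_module]; composing [T] with its
    inverse makes the coboundary exact. *)
Lemma univ_split_of_approx (T : BoundedOp univ_module I) (c : R) :
  0 <= c < 1 ->
  (forall a phi, norm (minus (delta0 T a phi) (univ_eval a phi)) <=
     c * norm a * norm phi) ->
  univ_split.
Proof.
intros Hc HT.
set (U := classify (delta0_z1 T)).
destruct (@near_identity_invertible univ_module U c Hc) as [S [HUS HSU]].
{ intros phi. apply opnorm_le.
  - apply Rmult_le_pos; [lra|apply norm_pos].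
  - intros a Ha.
    apply Rle_trans with (c * norm a * norm phi); [|].
    + eapply Rle_trans; [|apply HT]. apply Req_le, (f_equal norm).
      change (op_out (plus (U phi : op_space A I)
        (scal (Copp (RtoC 1)) (phi : op_space A I))) a =
        minus (delta0 T a phi) (univ_eval a phi)).
      transitivity (plus (delta0 T a phi)
        (scal (Copp (RtoC 1)) (univ_eval a phi))); [reflexivity|lin].
    + apply Rmult_le_compat_r; [apply norm_pos|].
      rewrite <- (Rmult_1_r c) at 2. apply Rmult_le_compat_l; lra. }
assert (HSact : forall a phi, S (act a phi) = act a (S phi)).
{ intros a phi. transitivity (S (act a (U (S phi)))); [now rewrite HUS|].
  rewrite <- (hom_act U). apply HSU. }
exists (comp_op T S). intros a phi.
transitivity (delta0 T a (S phi)).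
- unfold delta0. simpl. now rewrite HSact.
- change (univ_eval a (U (S phi)) = univ_eval a phi). now rewrite HUS.
Qed.

(** The operator [u] becomes a morphism once its coboundary is subtracted,
    pulled back from the universal cocycle. That coboundary vanishes on the
    image of [d], so the values there are kept. *)
Lemma univ_split_extension (X Y : LeftModule A) (d : Hom Y X)
    (u : BoundedOp X I) :
  univ_split ->
  (forall (a : A) (y : Y), u (d (act a y)) = act a (u (d y))) ->
  exists g : Hom X I, forall y, g (d y) = u (d y).
Proof.
intros [T HT] Hu.
set (F := classify (delta0_z1 u)).
assert (Hact : forall a x,
  minus_op u (comp_op T F) (act a x) = act a (minus_op u (comp_op T F) x)).
{ intros a x.
  change (minus (u (act a x)) (T (F (act a x))) =
    act a (minus (u x) (T (F x)))).
  assert (HF : F (act a x) = act a (F x)) by apply (hom_act F).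
  assert (E : minus (act a (T (F x))) (T (act a (F x))) =
    minus (act a (u x)) (u (act a x))) by exact (HT a (F x)).
  rewrite HF, act_minus.
  transitivity (minus (u (act a x)) (minus (act a (T (F x)))
    (minus (act a (T (F x))) (T (act a (F x)))))); [lin|].
  rewrite E. lin. }
exists {| hom_op := minus_op u (comp_op T F); hom_act := Hact |}.
intros y. change (minus (u (d y)) (T (F (d y))) = u (d y)).
assert (F (d y) = zero) as ->.
{ apply univ_ext. intros a.
  transitivity (zero : I); [|reflexivity].
  change (minus (act a (u (d y))) (u (act a (d y))) = zero).
  rewrite <- (hom_act d), Hu. lin. }
rewrite op_zero. lin.
Qed.

Lemma univ_split_injective : univ_split -> injective I.
Proof.
intros H X Y k [s Hs] f.
destruct (@univ_split_extension X Y k (comp_op f s) H) as [g Hg].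
- intros a y. simpl. now rewrite !Hs, (hom_act f).
- exists g. intros y. rewrite Hg. simpl. now rewrite Hs.
Qed.

(** ** The extension of a cocycle *)

Section Extension.

Variable X : LeftModule A.
Variable f : Z1 X I.

(** The retractions of this extension onto [I] are, on the second summand, the
    operators with coboundary [f]. *)
Definition ext_act (a : A) (p : prod_space I X) : prod_space I X :=
  pair_in (plus (act a (pfst p)) (f a (psnd p))) (act a (psnd p)).

Lemma ext_act_bilinear : is_bilinear ext_act.
Proof.
split; intros; unfold ext_act; rewrite ?pair_in_plus, ?pair_in_scal;
  apply pair_in_eq.
- rewrite (bilinear_plus_l (@act_bilinear A I)),
    (bilinear_plus_l (@z1_bilinear A X I f)). lin.
- apply (bilinear_plus_l (@act_bilinear A X)).
- rewrite (bilinear_scal_l (@act_bilinear A I)),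
    (bilinear_scal_l (@z1_bilinear A X I f)). lin.
- apply (bilinear_scal_l (@act_bilinear A X)).
- rewrite pfst_plus, psnd_plus, act_plus,
    (bilinear_plus_r (@z1_bilinear A X I f)). lin.
- rewrite psnd_plus. apply act_plus.
- rewrite pfst_scal, psnd_scal, act_scal,
    (bilinear_scal_r (@z1_bilinear A X I f)). lin.
- rewrite psnd_scal. apply act_scal.
Qed.

Lemma ext_act_bound :
  exists M, forall a p, norm (ext_act a p) <= M * norm a * norm p.
Proof.
destruct (act_bound I) as [M [HM HI]], (act_bound X) as [N [HN HX]],
  (z1_bound f) as [P [HP Hf]].
exists (M + N + P). intros a [y x]. unfold ext_act; simpl.
rewrite pair_norm. change (norm ((y, x) : prod_space I X)) with (norm y + norm x).
pose proof (norm_plus_le (act a y) (f a x)) as H.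
specialize (HI a y). specialize (HX a x). specialize (Hf a x).
pose proof (norm_pos a). pose proof (norm_pos x). pose proof (norm_pos y).
assert (0 <= norm a * norm x) by now apply Rmult_le_pos.
assert (0 <= norm a * norm y) by now apply Rmult_le_pos.
apply Rle_trans with
  (M * (norm a * norm y) + P * (norm a * norm x) + N * (norm a * norm x)).
{ eapply Rle_trans; [apply Rplus_le_compat_r, H|]. lra. }
assert (0 <= (N + P) * (norm a * norm y)) by (apply Rmult_le_pos; lra).
assert (0 <= M * (norm a * norm x)) by (apply Rmult_le_pos; lra).
lra.
Qed.

Lemma ext_act_assoc (a b : A) (p : prod_space I X) :
  ext_act (alg_mul a b) p = ext_act a (ext_act b p).
Proof.
unfold ext_act; apply pair_in_eq; simpl.
- rewrite act_assoc, z1_eq, act_plus. lin.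
- apply act_assoc.
Qed.

Definition ext_module : LeftModule A :=
  mk_module ext_act_bilinear ext_act_bound ext_act_assoc.

Lemma ext_incl_act (a : A) (y : I) :
  inl_op I X (act a y) = act a (inl_op I X y : ext_module).
Proof.
apply pair_in_eq; simpl.
- rewrite (bil_zero_r (@z1_bilinear A X I f)). lin.
- symmetry; apply act_zero.
Qed.

Definition ext_incl : Hom I ext_module :=
  {| hom_op := (inl_op I X : BoundedOp I ext_module); hom_act := ext_incl_act |}.

Lemma ext_incl_admissible : admissible_mono ext_incl.
Proof. exists (fst_op I X). reflexivity. Qed.

Lemma ext_act_inr (a : A) (x : X) :
  act a (inr_op I X x : ext_module) =
  plus (ext_incl (f a x)) (inr_op I X (act a x)).
Proof.
transitivity (pair_in (plus (f a x) zero) (plus zero (act a x)));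
  [|reflexivity].
apply pair_in_eq; simpl; [|lin]. rewrite act_zero. lin.
Qed.

(** Both summands on the right vanish for a retraction morphism, and are small
    for an approximate one. *)
Lemma ext_retraction_delta0 (psi : BoundedOp ext_module I) (a : A) (x : X) :
  minus (delta0 (comp_op psi (inr_op I X)) a x) (f a x) =
  plus (minus (psi (ext_incl (f a x))) (f a x))
    (minus (act a (psi (inr_op I X x)))
       (psi (act a (inr_op I X x : ext_module)))).
Proof.
rewrite ext_act_inr, op_plus. unfold delta0. simpl. lin.
Qed.

End Extension.

Lemma injective_coboundary (X : LeftModule A) (f : Z1 X I) :
  injective I ->
  exists T : BoundedOp X I, forall a x, delta0 T a x = f a x.
Proof.
intros HI.
assert (Hid : forall (a : A) (x : I), id_op I (act a x) = act a (id_op I x))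
  by reflexivity.
destruct (HI _ _ _ (ext_incl_admissible f) {| hom_op := id_op I; hom_act := Hid |})
  as [r Hr].
assert (Hr' : forall y, r (ext_incl f y) = y) by exact Hr.
exists (comp_op r (inr_op I X)). intros a x.
apply minus_zero_eq. rewrite ext_retraction_delta0, Hr', (hom_act r). lin.
Qed.

Lemma injective_univ_split : injective I -> univ_split.
Proof. exact (injective_coboundary univ_cocycle). Qed.

(** The two errors, of retraction and of equivariance, bound together the
    distance of a coboundary from [univ_cocycle]. *)
Lemma univ_split_of_retraction (psi : BoundedOp (ext_module univ_cocycle) I)
    (c e : R) :
  0 <= c -> 0 <= e -> c + e < 1 ->
  (forall y, norm (minus (psi (ext_incl univ_cocycle y)) y) <= c * norm y) ->
  (forall a p, norm (minus (psi (act a p)) (act a (psi p))) <=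
     e * norm a * norm p) ->
  univ_split.
Proof.
intros Hc He Hce Hret Hact.
apply (@univ_split_of_approx (comp_op psi (inr_op I univ_module)) (c + e)).
- lra.
- intros a phi.
  eapply norm_le_eq; [exact (ext_retraction_delta0 (f := univ_cocycle) psi a phi)|].
  eapply Rle_trans; [apply norm_plus_le|].
  rewrite !Rmult_plus_distr_r. apply Rplus_le_compat.
  + eapply Rle_trans; [apply Hret|]. rewrite Rmult_assoc.
    apply Rmult_le_compat_l; [exact Hc|]. apply univ_eval_norm.
  + rewrite norm_minus_sym. eapply Rle_trans; [apply Hact|].
    apply Req_le. f_equal.
    transitivity (norm (zero : I) + norm phi); [reflexivity|].
    rewrite norm_0. lra.
Qed.

End Universal.

(** * Nets *)

Definition unit_net : DirectedSet.
Proof.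
refine {| dir_index := unit; dir_le := fun _ _ => True |}; easy.
Defined.

Lemma net_norm_small (N : DirectedSet) (u : N -> R) (eps : R) :
  filterlim u (eventually_in (N := N)) (locally 0) -> 0 < eps ->
  exists n0, forall n, dir_le n0 n -> u n < eps.
Proof.
intros H Heps.
destruct (H (fun r => r < eps)) as [n0 Hn0].
- exists (mkposreal eps Heps). intros r Hr.
  change (Rabs (r - 0) < eps) in Hr. rewrite Rminus_0_r in Hr.
  pose proof (Rle_abs r). lra.
- now exists n0.
Qed.

Lemma constant_net_lim (N : DirectedSet) (u : N -> R) :
  (forall n, u n = 0) ->
  filterlim u (eventually_in (N := N)) (locally 0).
Proof.
intros H P [eps HP]. destruct (dir_inhabited N) as [n0].
exists n0. intros n _. apply HP. rewrite H. apply ball_center.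
Qed.

Lemma opnorm_zero (X Y : BanachSpace) (f : X -> Y) :
  (forall x, f x = zero) -> opnorm f = 0.
Proof.
intros H. apply Rle_antisym.
- apply opnorm_le; [lra|]. intros x _. rewrite H, norm_0. lra.
- replace (opnorm f) with (opnorm (zero_op X Y)); [apply opnorm_ge_0|].
  f_equal. apply functional_extensionality. intros x. now rewrite H.
Qed.

Lemma opnorm_net_exact (N : DirectedSet) (X Y : BanachSpace)
    (u : N -> X -> Y) (v : X -> Y) :
  (forall n x, u n x = v x) -> converges_in_opnorm u v.
Proof.
intros H. apply constant_net_lim. intros n. apply opnorm_zero.
intros x. rewrite H. lin.
Qed.

Lemma bilnorm_zero (X Y Z : BanachSpace) (f : X -> Y -> Z) :
  (forall x y, f x y = zero) -> bilnorm f = 0.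
Proof.
intros H. apply Rle_antisym.
- apply bilnorm_le; [lra|]. intros x y _ _. rewrite H, norm_0. lra.
- apply Lub_Rbar_ge with (c := 0).
  + intros r (x & y & _ & _ & ->). rewrite H, norm_0. lra.
  + exists zero, zero. rewrite H, !norm_0. repeat split; lra.
Qed.

Lemma exact_uniform_approximate (A : BanachAlgebra) (X Y : LeftModule A)
    (N : DirectedSet) (f : Hom X Y) :
  uniform_approximate_morphism (fun _ : N => f : BoundedOp X Y).
Proof.
intros S T _ _ eps Heps. destruct (dir_inhabited N) as [n0].
exists n0. intros n _ a x _ _. rewrite (hom_act f).
norm_as (zero : Y). now rewrite norm_0.
Qed.

Section Criteria.

Variable A : BanachAlgebra.
Variable I : LeftModule A.

(** A single term of the net suffices, with both errors at most [1 / 4]. *)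
Lemma univ_split_of_net (N : DirectedSet)
    (psi : N -> BoundedOp (ext_module (univ_cocycle I)) I) :
  uniform_approximate_morphism psi ->
  converges_in_opnorm (fun n y => psi n (ext_incl (univ_cocycle I) y))
    (fun y : I => y) ->
  univ_split I.
Proof.
intros Hua Hconv.
destruct (net_norm_small (eps := / 4) Hconv ltac:(lra)) as [n1 H1].
destruct (Hua (fun a => norm a <= 1) (fun x => norm x <= 1)) with (eps := / 4)
  as [n2 H2].
- now exists 1.
- now exists 1.
- lra.
- destruct (dir_directed n1 n2) as [n [Hn1 Hn2]].
  specialize (H1 n Hn1). specialize (H2 n Hn2). simpl in H1.
  apply univ_split_of_retraction with (psi := psi n) (c := / 4) (e := / 4); try lra.
  + intros y.
    pose proof (opnorm_bound (minus_op (comp_op (psi n) (ext_incl (univ_cocycle I)))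
      (id_op I)) y) as Hb.
    eapply Rle_trans; [exact Hb|].
    apply Rmult_le_compat_r; [apply norm_pos|]. left; exact H1.
  + intros a p.
    rewrite norm_minus_sym.
    apply (bilinear_unit_bound (f := delta0 (psi n))).
    * apply delta0_bilinear.
    * lra.
    * intros b q Hb Hq. unfold delta0. rewrite norm_minus_sym.
      left. now apply H2.
Qed.

Lemma univ_split_of_delta0_net (N : DirectedSet)
    (T : N -> BoundedOp (univ_module I) I) :
  converges_in_bilnorm (fun n => delta0 (T n)) (univ_cocycle I) ->
  univ_split I.
Proof.
intros Hconv.
destruct (net_norm_small (eps := / 2) Hconv ltac:(lra)) as [n Hn].
specialize (Hn n (dir_refl n)). simpl in Hn.
apply univ_split_of_approx with (T := T n) (c := / 2); [lra|].
assert (Hbil : is_bilinear (fun (a : A) (phi : univ_module I) =>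
  minus (delta0 (T n) a phi) (univ_eval a phi))).
{ pose proof (delta0_bilinear (T n)) as H1.
  pose proof (univ_eval_bilinear I) as H2.
  split; intros.
  - rewrite (bilinear_plus_l H1), (bilinear_plus_l H2). lin.
  - rewrite (bilinear_scal_l H1), (bilinear_scal_l H2). lin.
  - rewrite (bilinear_plus_r H1), (bilinear_plus_r H2). lin.
  - rewrite (bilinear_scal_r H1), (bilinear_scal_r H2). lin. }
assert (Hcont : jointly_continuous (fun (a : A) (phi : univ_module I) =>
  minus (delta0 (T n) a phi) (univ_eval a phi))).
{ destruct (delta0_bound (T n)) as [M HM].
  apply (bilinear_continuous Hbil (M := M + 1)). intros a phi.
  eapply Rle_trans; [apply norm_minus_le|].
  specialize (HM a phi). pose proof (univ_eval_norm a phi). lra. }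
intros a phi.
eapply Rle_trans; [apply (bilnorm_bound Hbil Hcont)|].
apply Rmult_le_compat_r; [apply norm_pos|].
apply Rmult_le_compat_r; [apply norm_pos|].
left; exact Hn.
Qed.

Lemma id_hom_act (X : LeftModule A) (a : A) (x : X) :
  id_op X (act a x) = act a (id_op X x).
Proof. reflexivity. Qed.

Definition id_hom (X : LeftModule A) : Hom X X :=
  {| hom_op := id_op X; hom_act := @id_hom_act X |}.

Lemma comp_hom_act (X Y Z : LeftModule A) (g : Hom Y Z) (f : Hom X Y) a x :
  comp_op g f (act a x) = act a (comp_op g f x).
Proof. simpl. now rewrite (hom_act f), (hom_act g). Qed.

Definition comp_hom (X Y Z : LeftModule A) (g : Hom Y Z) (f : Hom X Y) : Hom X Z :=
  {| hom_op := comp_op g f; hom_act := comp_hom_act g f |}.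

Lemma uniform_approximate_comp (X Y : LeftModule A) (N : DirectedSet)
    (rho : N -> BoundedOp Y I) (f : Hom X Y) :
  uniform_approximate_morphism rho ->
  uniform_approximate_morphism (fun n => comp_op (rho n) f).
Proof.
intros H S T HS [M HM] eps Heps.
destruct (op_bound f) as [C [HC Hf]].
destruct (H S (fun y => exists x, T x /\ y = f x) HS) with (eps := eps)
  as [n0 Hn0]; [|exact Heps|].
- exists (C * M). intros y [x [Hx ->]]. eapply Rle_trans; [apply Hf|].
  apply Rmult_le_compat_l; [lra|now apply HM].
- exists n0. intros n Hn a x Ha Hx. simpl. rewrite (hom_act f).
  apply Hn0; [exact Hn|exact Ha|now exists x].
Qed.

(** The coboundaries are not only dense: with [s] the contracting homotopy,
    [u = f s_1] satisfies [u d_0 = f] because [f d_1 = 0], and it can be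
    corrected to a morphism off the image of [d_0]. *)
Lemma injective_ext1_trivial :
  injective I -> forall X : LeftModule A, Ext_topology_trivial 1 X I.
Proof.
intros HI X P f Hf eps Heps.
destruct (res_admissible P) as [s [_ Hs]].
(* Degree 1 of the augmented complex is degree 0 of the resolution. *)
specialize (Hs 1%nat). simpl in Hs.
set (u := comp_op f (s 1%nat) : BoundedOp (P 0%nat) I).
assert (Hu : forall y, u (diff P 0 y) = f y).
{ intros y. specialize (Hs y). unfold u; simpl.
  rewrite <- Hs at 2. rewrite op_plus, Hf. lin. }
destruct (@univ_split_extension A I (P 0%nat) (P 1%nat) (diff P 0) u
  (injective_univ_split HI)) as [g Hg].
- intros a y. rewrite !Hu. apply (hom_act f).
- exists f. split.
  + exists g. intros y. now rewrite Hg, Hu.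
  + rewrite opnorm_zero; [exact Heps|]. intros x. lin.
Qed.

End Criteria.

(** * Completion *)

(** A complex seminormed space. Its vector space laws hold only up to distance
    zero, which is all that formal sums satisfy. *)
Record PreBanach := {
  pre_carrier :> Type;
  pre_zero : pre_carrier;
  pre_plus : pre_carrier -> pre_carrier -> pre_carrier;
  pre_scal : C -> pre_carrier -> pre_carrier;
  pre_dist : pre_carrier -> pre_carrier -> R;
  pre_dist_refl : forall v, pre_dist v v = 0;
  pre_dist_sym : forall v w, pre_dist v w = pre_dist w v;
  pre_dist_tri : forall u v w, pre_dist u w <= pre_dist u v + pre_dist v w;
  pre_dist_plus : forall v v' w w',
    pre_dist (pre_plus v v') (pre_plus w w') <= pre_dist v w + pre_dist v' w';
  pre_dist_scal : forall k v w,
    pre_dist (pre_scal k v) (pre_scal k w) <= Cmod k * pre_dist v w;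
  pre_comm : forall v w, pre_dist (pre_plus v w) (pre_plus w v) = 0;
  pre_assoc : forall u v w,
    pre_dist (pre_plus u (pre_plus v w)) (pre_plus (pre_plus u v) w) = 0;
  pre_zero_r : forall v, pre_dist (pre_plus v pre_zero) v = 0;
  pre_opp_r : forall v,
    pre_dist (pre_plus v (pre_scal (Copp (RtoC 1)) v)) pre_zero = 0;
  pre_scal_assoc : forall k l v,
    pre_dist (pre_scal k (pre_scal l v)) (pre_scal (Cmult k l) v) = 0;
  pre_scal_one : forall v, pre_dist (pre_scal (RtoC 1) v) v = 0;
  pre_distr_l : forall k v w,
    pre_dist (pre_scal k (pre_plus v w))
      (pre_plus (pre_scal k v) (pre_scal k w)) = 0;
  pre_distr_r : forall k l v,
    pre_dist (pre_scal (Cplus k l) v)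
      (pre_plus (pre_scal k v) (pre_scal l v)) = 0
}.

Section Completion.

Variable V : PreBanach.
Notation D := (@pre_dist V).
Notation "v +' w" := (pre_plus v w) (at level 50, left associativity).
Notation "k *' v" := (pre_scal k v) (at level 40, left associativity).
Notation "0'" := (pre_zero V).
Notation mone := (Copp (RtoC 1)).

Lemma pre_dist_pos v w : 0 <= D v w.
Proof.
pose proof (pre_dist_tri v w v) as H.
rewrite pre_dist_refl, (pre_dist_sym w v) in H. lra.
Qed.

Lemma pre_dist_minus_le v w : D (v +' mone *' w) 0' <= D v w.
Proof.
eapply Rle_trans; [apply (pre_dist_tri _ (w +' mone *' w))|].
rewrite pre_opp_r.
pose proof (pre_dist_plus v (mone *' w) w (mone *' w)) as H.
rewrite pre_dist_refl in H. lra.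
Qed.

Lemma pre_dist_minus_ge v w : D v w <= D (v +' mone *' w) 0'.
Proof.
pose proof (pre_dist_tri v (v +' 0') w) as H1.
rewrite (pre_dist_sym v (v +' 0')), pre_zero_r in H1.
pose proof (pre_dist_tri (v +' 0') (v +' (mone *' w +' w)) w) as H2.
pose proof (pre_dist_plus v 0' v (mone *' w +' w)) as H3.
rewrite pre_dist_refl in H3.
pose proof (pre_dist_tri 0' (w +' mone *' w) (mone *' w +' w)) as H4.
rewrite (pre_dist_sym 0' (w +' mone *' w)), pre_opp_r, pre_comm in H4.
pose proof (pre_dist_tri (v +' (mone *' w +' w)) (v +' mone *' w +' w) w) as H5.
rewrite pre_assoc in H5.
pose proof (pre_dist_tri (v +' mone *' w +' w) (0' +' w) w) as H6.
pose proof (pre_dist_plus (v +' mone *' w) w 0' w) as H7.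
rewrite pre_dist_refl in H7.
pose proof (pre_dist_tri (0' +' w) (w +' 0') w) as H8.
rewrite pre_comm, pre_zero_r in H8. lra.
Qed.

(** A point of the Hausdorff completion, represented by its distances to the
    points of [V]: equality of points is then equality of functions, and no
    quotient of Cauchy sequences is formed. A small value [p v] says that [v]
    approximates [p], which is how all constructions below proceed. *)
Record point := {
  point_dist :> V -> R;
  point_small : forall e, 0 < e -> exists v, point_dist v <= e;
  point_tri : forall v w, Rabs (point_dist w - D v w) <= point_dist v
}.

Implicit Types p q : point.

Lemma point_pos p v : 0 <= p v.
Proof. eapply Rle_trans; [apply Rabs_pos|apply (point_tri p v v)]. Qed.

Lemma point_move p v w : p w <= p v + D v w.
Proof.
pose proof (point_tri p v w) as H. pose proof (Rle_abs (p w - D v w)). lra.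
Qed.

Lemma point_between p v w : D v w <= p v + p w.
Proof.
pose proof (point_tri p v w) as H. pose proof (Rle_abs (- (p w - D v w))) as H1.
rewrite Rabs_Ropp in H1. lra.
Qed.

Lemma point_eq p q :
  (forall e, 0 < e -> exists v w, p v <= e /\ q w <= e /\ D v w <= e) -> p = q.
Proof.
intros H.
assert (Hle : forall u, p u = q u).
{ intros u. apply Rle_antisym; apply le_epsilon; intros e He;
  destruct (H (e / 3)) as (v & w & Hv & Hw & Hvw); try lra.
  - pose proof (point_move p v u). pose proof (point_between q w u).
    pose proof (pre_dist_tri v w u). lra.
  - pose proof (point_move q w u). pose proof (point_between p v u).
    pose proof (pre_dist_tri w v u). rewrite (pre_dist_sym w v) in *. lra. }
destruct p as [f F1 F2], q as [g G1 G2]; simpl in Hle.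
assert (f = g) as -> by (now apply functional_extensionality).
f_equal; apply proof_irrelevance.
Qed.

(** The distance from [u] to the point approximated by [B] is the infimum of
    [D v u + e] over the approximations [v] with error [e]. *)
Lemma point_of_approx (B : R -> V -> Prop) :
  (forall e, 0 < e -> exists v, B e v) ->
  (forall e v e' v', B e v -> B e' v' -> D v v' <= e + e') ->
  exists p, forall e v, B e v -> p v <= e.
Proof.
intros Hex Hcl.
assert (Hpos : forall e v, B e v -> 0 <= e).
{ intros e v H. pose proof (Hcl _ _ _ _ H H). rewrite pre_dist_refl in *. lra. }
set (E := fun u r => exists e v, B e v /\ r = D v u + e).
set (f := fun u => real (Glb_Rbar (E u))).
assert (HE0 : forall u r, E u r -> 0 <= r).
{ intros u r (e & v & H & ->). pose proof (Hpos _ _ H).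
  pose proof (pre_dist_pos v u). lra. }
assert (Hinf : forall u, (forall e v, B e v -> f u <= D v u + e) /\
  (forall c, (forall e v, B e v -> c <= D v u + e) -> c <= f u)).
{ intros u. destruct (Hex 1 Rlt_0_1) as [v0 Hv0].
  destruct (Glb_Rbar_correct (E u)) as [Hlb Hglb].
  assert (H0 : Rbar_le 0 (Glb_Rbar (E u))).
  { apply Hglb. intros r Hr. now apply (HE0 u). }
  pose proof (Hlb (D v0 u + 1) (ex_intro _ 1 (ex_intro _ v0 (conj Hv0 eq_refl)))) as H1.
  assert (Hfin : is_finite (Glb_Rbar (E u))).
  { destruct (Glb_Rbar (E u)); simpl in *; [reflexivity|contradiction|contradiction]. }
  unfold f. rewrite <- Hfin in Hlb, Hglb. split.
  - intros e v Hv. apply (Hlb (D v u + e)). now exists e, v.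
  - intros c Hc. apply (Hglb (Finite c)).
    intros r (e & v & Hv & ->). now apply Hc. }
assert (Hf : forall e v, B e v -> f v <= e).
{ intros e v Hv. pose proof (proj1 (Hinf v) e v Hv) as H.
  rewrite pre_dist_refl in H. lra. }
assert (Hsmall : forall e, 0 < e -> exists v, f v <= e).
{ intros e He. destruct (Hex e He) as [v Hv]. exists v. now apply Hf. }
assert (Htri : forall v w, Rabs (f w - D v w) <= f v).
{ intros v w. apply Rabs_le. split.
  - assert (D v w - f w <= f v); [|lra].
    apply (proj2 (Hinf v)). intros e u Hu.
    assert (D v w - (D u v + e) <= f w); [|lra].
    apply (proj2 (Hinf w)). intros e' u' Hu'.
    pose proof (Hcl _ _ _ _ Hu Hu').
    pose proof (pre_dist_tri v u w). pose proof (pre_dist_tri u u' w).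
    rewrite (pre_dist_sym v u) in *. lra.
  - assert (f w - D v w <= f v); [|lra].
    apply (proj2 (Hinf v)). intros e u Hu.
    pose proof (proj1 (Hinf w) e u Hu).
    pose proof (pre_dist_tri u v w). lra. }
exists (Build_point Hsmall Htri). exact Hf.
Qed.

Lemma point_in_small v e : 0 < e -> exists w, D v w <= e.
Proof. intros He. exists v. rewrite pre_dist_refl. lra. Qed.

Lemma point_in_tri u v w : Rabs (D u w - D v w) <= D u v.
Proof.
apply Rabs_le. pose proof (pre_dist_tri u v w). pose proof (pre_dist_tri v u w).
rewrite (pre_dist_sym v u) in *. lra.
Qed.

Definition point_in (v : V) : point :=
  {| point_dist := D v; point_small := @point_in_small v;
     point_tri := @point_in_tri v |}.

Lemma point_in_eq v w : D v w = 0 -> point_in v = point_in w.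
Proof.
intros H. apply point_eq. intros e He. exists v, w. simpl.
rewrite !pre_dist_refl, H. lra.
Qed.

Lemma point_plus_ex p q : exists r : point, forall v w, r (v +' w) <= p v + q w.
Proof.
destruct (@point_of_approx (fun e u => exists v w, u = v +' w /\ p v + q w <= e))
  as [r Hr].
- intros e He. destruct (point_small p (e := e / 2)) as [v Hv]; [lra|].
  destruct (point_small q (e := e / 2)) as [w Hw]; [lra|].
  exists (v +' w), v, w. split; [reflexivity|lra].
- intros e u e' u' (v & w & -> & H) (v' & w' & -> & H').
  pose proof (pre_dist_plus v w v' w'). pose proof (point_between p v v').
  pose proof (point_between q w w'). lra.
- exists r. intros v w. apply Hr. exists v, w. split; [reflexivity|lra].
Qed.

Definition point_plus p q : point :=
  proj1_sig (constructive_indefinite_description _ (point_plus_ex p q)).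

Lemma point_plus_spec p q v w : point_plus p q (v +' w) <= p v + q w.
Proof.
exact (proj2_sig (constructive_indefinite_description _ (point_plus_ex p q)) v w).
Qed.

Lemma point_scal_ex (k : C) p : exists r : point, forall v, r (k *' v) <= Cmod k * p v.
Proof.
pose proof (Cmod_ge_0 k) as Hk.
destruct (@point_of_approx (fun e u => exists v, u = k *' v /\ Cmod k * p v <= e))
  as [r Hr].
- intros e He. destruct (point_small p (e := e / (Cmod k + 1))) as [v Hv].
  { apply Rdiv_lt_0_compat; lra. }
  exists (k *' v), v. split; [reflexivity|].
  apply Rle_trans with (Cmod k * (e / (Cmod k + 1))).
  + now apply Rmult_le_compat_l.
  + apply Rle_trans with ((Cmod k + 1) * (e / (Cmod k + 1))); [|right; field; lra].
    apply Rmult_le_compat_r; [|lra].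
    apply Rdiv_le_0_compat; lra.
- intros e u e' u' (v & -> & H) (v' & -> & H').
  pose proof (pre_dist_scal k v v'). pose proof (point_between p v v').
  assert (Cmod k * D v v' <= Cmod k * (p v + p v')) by now apply Rmult_le_compat_l.
  lra.
- exists r. intros v. apply Hr. exists v. split; [reflexivity|lra].
Qed.

Definition point_scal (k : C) p : point :=
  proj1_sig (constructive_indefinite_description _ (point_scal_ex k p)).

Lemma point_scal_spec k p v : point_scal k p (k *' v) <= Cmod k * p v.
Proof.
exact (proj2_sig (constructive_indefinite_description _ (point_scal_ex k p)) v).
Qed.

(** Reduces a vector space law for points to the same law for approximations,
    whose errors add up to a multiple [K * e] depending on the law. *)
Lemma point_eq_scaled p q (K : R) :
  0 < K ->
  (forall e, 0 < e -> exists v w, p v <= K * e /\ q w <= K * e /\ D v w = 0) ->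
  p = q.
Proof.
intros HK H. apply point_eq. intros e He.
destruct (H (e / K)) as (v & w & Hv & Hw & Hvw).
{ now apply Rdiv_lt_0_compat. }
exists v, w. replace (K * (e / K)) with e in * by (field; lra).
rewrite Hvw. lra.
Qed.

Lemma point_plus_comm p q : point_plus p q = point_plus q p.
Proof.
apply point_eq_scaled with (K := 2); [lra|]. intros e He.
destruct (point_small p He) as [v Hv], (point_small q He) as [w Hw].
exists (v +' w), (w +' v).
pose proof (point_plus_spec p q v w). pose proof (point_plus_spec q p w v).
rewrite pre_comm. lra.
Qed.

Lemma point_plus_assoc p q (r : point) :
  point_plus p (point_plus q r) = point_plus (point_plus p q) r.
Proof.
apply point_eq_scaled with (K := 3); [lra|]. intros e He.
destruct (point_small p He) as [u Hu], (point_small q He) as [v Hv],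
  (point_small r He) as [w Hw].
exists (u +' (v +' w)), (u +' v +' w). rewrite pre_assoc.
pose proof (point_plus_spec p (point_plus q r) u (v +' w)).
pose proof (point_plus_spec q r v w).
pose proof (point_plus_spec (point_plus p q) r (u +' v) w).
pose proof (point_plus_spec p q u v). lra.
Qed.

Lemma point_plus_zero p : point_plus p (point_in 0') = p.
Proof.
apply point_eq_scaled with (K := 1); [lra|]. intros e He.
destruct (point_small p He) as [v Hv].
exists (v +' 0'), v. rewrite pre_zero_r.
pose proof (point_plus_spec p (point_in 0') v 0') as H. simpl in H.
rewrite pre_dist_refl in H. lra.
Qed.

Lemma point_plus_opp p : point_plus p (point_scal mone p) = point_in 0'.
Proof.
apply point_eq_scaled with (K := 2); [lra|]. intros e He.
destruct (point_small p He) as [v Hv].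
exists (v +' mone *' v), 0'. rewrite pre_opp_r.
pose proof (point_plus_spec p (point_scal mone p) v (mone *' v)) as H.
pose proof (point_scal_spec mone p v) as H1.
rewrite Cmod_opp, Cmod_1 in H1. simpl. rewrite pre_dist_refl. lra.
Qed.

Lemma point_scal_le k p v e : p v <= e -> point_scal k p (k *' v) <= Cmod k * e.
Proof.
intros H. eapply Rle_trans; [apply point_scal_spec|].
apply Rmult_le_compat_l; [apply Cmod_ge_0|exact H].
Qed.

Lemma point_plus_le p q v w e e' :
  p v <= e -> q w <= e' -> point_plus p q (v +' w) <= e + e'.
Proof.
intros H H'. eapply Rle_trans; [apply point_plus_spec|]. lra.
Qed.

Lemma point_scal_assoc (k l : C) p :
  point_scal k (point_scal l p) = point_scal (mult (k : C_Ring) l) p.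
Proof.
pose proof (Cmod_ge_0 k). pose proof (Cmod_ge_0 l).
assert (0 <= Cmod k * Cmod l) by now apply Rmult_le_pos.
apply point_eq_scaled with (K := Cmod k * Cmod l + 1); [lra|]. intros e He.
destruct (point_small p He) as [v Hv].
exists (k *' (l *' v)), (Cmult k l *' v). rewrite pre_scal_assoc.
pose proof (point_scal_le k (point_scal_le l Hv)) as H2.
pose proof (point_scal_le (Cmult k l) Hv) as H3.
rewrite Cmod_mult in H3.
change (mult (k : C_Ring) l) with (Cmult k l). lra.
Qed.

Lemma point_scal_one p : point_scal (one : C_Ring) p = p.
Proof.
apply point_eq_scaled with (K := 1); [lra|]. intros e He.
destruct (point_small p He) as [v Hv].
exists (RtoC 1 *' v), v. rewrite pre_scal_one.
pose proof (point_scal_le (RtoC 1) Hv) as H. rewrite Cmod_1 in H.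
change (one : C_Ring) with (RtoC 1). lra.
Qed.

Lemma point_scal_distr_l (k : C) p q :
  point_scal k (point_plus p q) = point_plus (point_scal k p) (point_scal k q).
Proof.
pose proof (Cmod_ge_0 k).
apply point_eq_scaled with (K := 2 * Cmod k + 1); [lra|]. intros e He.
destruct (point_small p He) as [v Hv], (point_small q He) as [w Hw].
exists (k *' (v +' w)), (k *' v +' k *' w). rewrite pre_distr_l.
pose proof (point_scal_le k (point_plus_le Hv Hw)).
pose proof (point_plus_le (point_scal_le k Hv) (point_scal_le k Hw)). lra.
Qed.

Lemma point_scal_distr_r (k l : C) p :
  point_scal (plus (k : C_Ring) l) p = point_plus (point_scal k p) (point_scal l p).
Proof.
pose proof (Cmod_ge_0 k). pose proof (Cmod_ge_0 l).
apply point_eq_scaled with (K := Cmod k + Cmod l + 1); [lra|]. intros e He.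
destruct (point_small p He) as [v Hv].
exists (Cplus k l *' v), (k *' v +' l *' v). rewrite pre_distr_r.
pose proof (point_scal_le (Cplus k l) Hv) as H1.
pose proof (point_plus_le (point_scal_le k Hv) (point_scal_le l Hv)) as H2.
assert (Cmod (Cplus k l) * e <= (Cmod k + Cmod l) * e).
{ apply Rmult_le_compat_r; [lra|apply Cmod_triangle]. }
change (plus (k : C_Ring) l) with (Cplus k l). lra.
Qed.

Definition point_AbelianMonoid : AbelianMonoid :=
  AbelianMonoid.Pack point
    (AbelianMonoid.Mixin _ _ _ point_plus_comm point_plus_assoc point_plus_zero)
    point.

Definition point_AbelianGroup : AbelianGroup :=
  AbelianGroup.Pack point
    (AbelianGroup.Class _ (AbelianMonoid.class point_AbelianMonoid)
      (AbelianGroup.Mixin point_AbelianMonoid _ point_plus_opp))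
    point.

Definition point_ModuleSpace : ModuleSpace C_Ring :=
  ModuleSpace.Pack C_Ring point
    (ModuleSpace.Class C_Ring _ (AbelianGroup.class point_AbelianGroup)
      (ModuleSpace.Mixin C_Ring point_AbelianGroup _ point_scal_assoc
         point_scal_one point_scal_distr_l point_scal_distr_r))
    point.

Definition point_norm (p : point_ModuleSpace) : R := point_dist p 0'.

Lemma point_norm_plus (p q : point_ModuleSpace) :
  point_norm (plus p q) <= point_norm p + point_norm q.
Proof.
change (point_plus p q 0' <= point_dist p 0' + point_dist q 0').
eapply Rle_trans; [apply (point_move _ (0' +' 0'))|].
rewrite pre_zero_r, Rplus_0_r. apply point_plus_spec.
Qed.

Lemma pre_scal_zero (k : C) : D (k *' 0') 0' = 0.
Proof.
apply Rle_antisym; [|apply pre_dist_pos].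
pose proof (pre_distr_l k 0' 0') as H1.
pose proof (pre_dist_scal k (0' +' 0') 0') as H2.
rewrite pre_zero_r, Rmult_0_r in H2.
pose proof (pre_dist_minus_le (k *' 0' +' k *' 0') (k *' 0')) as H3.
pose proof (pre_dist_tri (k *' 0' +' k *' 0') (k *' (0' +' 0')) (k *' 0')) as H4.
rewrite (pre_dist_sym _ (k *' (0' +' 0'))), H1 in H4.
set (z := k *' 0') in *.
pose proof (pre_dist_tri z (z +' 0') 0') as H5.
rewrite (pre_dist_sym z (z +' 0')), pre_zero_r in H5.
pose proof (pre_dist_plus z 0' z (z +' mone *' z)) as H6.
rewrite pre_dist_refl, (pre_dist_sym 0' (z +' mone *' z)), pre_opp_r in H6.
pose proof (pre_dist_tri (z +' 0') (z +' (z +' mone *' z)) 0') as H7.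
pose proof (pre_dist_tri (z +' (z +' mone *' z)) (z +' z +' mone *' z) 0') as H8.
rewrite pre_assoc in H8. lra.
Qed.

Lemma point_norm_scal (k : C) (p : point_ModuleSpace) :
  point_norm (scal k p) <= Cmod k * point_norm p.
Proof.
change (point_scal k p 0' <= Cmod k * point_dist p 0').
eapply Rle_trans; [apply (point_move _ (k *' 0'))|].
rewrite pre_scal_zero, Rplus_0_r. apply point_scal_spec.
Qed.

Lemma point_norm_zero (p : point_ModuleSpace) : point_norm p = 0 -> p = zero.
Proof.
intros H. apply point_eq. intros e He. exists 0', 0'.
change (point_dist p 0' = 0) in H. rewrite H. simpl.
rewrite pre_dist_refl. lra.
Qed.

Lemma point_norm_minus_le (p q : point_ModuleSpace) v w :
  point_norm (minus p q) <= point_dist p v + point_dist q w + D v w.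
Proof.
change (point_plus p (point_scal mone q) 0' <= p v + q w + D v w).
eapply Rle_trans; [apply (point_move _ (v +' mone *' w))|].
apply Rplus_le_compat; [|apply pre_dist_minus_le].
apply point_plus_le; [lra|].
pose proof (point_scal_spec mone q w) as H.
rewrite Cmod_opp, Cmod_1 in H. lra.
Qed.

Lemma point_norm_minus_ge (p q : point_ModuleSpace) v w :
  D v w <= point_norm (minus p q) + point_dist p v + point_dist q w.
Proof.
change (D v w <= point_plus p (point_scal mone q) 0' + p v + q w).
eapply Rle_trans; [apply pre_dist_minus_ge|].
eapply Rle_trans; [apply (point_between (point_plus p (point_scal mone q)))|].
pose proof (point_plus_spec p (point_scal mone q) v (mone *' w)) as H.
pose proof (point_scal_spec mone q w) as H1.
rewrite Cmod_opp, Cmod_1 in H1. lra.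
Qed.

(** The limit is approximated by every [v] near some [u n], with the tail
    oscillation of the sequence from [n] on added to the error. *)
Lemma point_complete (u : nat -> point_ModuleSpace) :
  cauchy_seq point_norm u -> exists x, seq_lim point_norm u x.
Proof.
intros Hu.
destruct (@point_of_approx (fun e v => exists n e1 e2,
  point_dist (u n) v <= e1 /\
  (forall m, (n <= m)%nat -> point_norm (minus (u n) (u m)) <= e2) /\
  e1 + e2 <= e)) as [p Hp].
- intros e He. destruct (Hu (e / 2)) as [n Hn]; [lra|].
  destruct (point_small (u n) (e := e / 2)) as [v Hv]; [lra|].
  exists v, n, (e / 2), (e / 2). repeat split; [exact Hv| |lra].
  intros m Hm. left. now apply Hn.
- assert (Hcl : forall n e1 e2 v n' e1' v', (n <= n')%nat ->
    point_dist (u n) v <= e1 ->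
    (forall m, (n <= m)%nat -> point_norm (minus (u n) (u m)) <= e2) ->
    point_dist (u n') v' <= e1' -> D v v' <= e1 + e2 + e1').
  { intros n e1 e2 v n' e1' v' Hnn' Hv H2 Hv'.
    pose proof (point_norm_minus_ge (u n) (u n') v v').
    specialize (H2 n' Hnn'). lra. }
  intros e v e' v' (n & e1 & e2 & Hv & H2 & He) (n' & e1' & e2' & Hv' & H2' & He').
  assert (Hself : forall q : point_ModuleSpace, 0 <= point_norm (minus q q)).
  { intros q. apply point_pos. }
  pose proof (Rle_trans _ _ _ (Hself (u n)) (H2 n (Nat.le_refl n))).
  pose proof (Rle_trans _ _ _ (Hself (u n')) (H2' n' (Nat.le_refl n'))).
  destruct (Nat.le_ge_cases n n') as [Hnn|Hnn].
  + pose proof (Hcl _ _ _ _ _ _ _ Hnn Hv H2 Hv'). lra.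
  + pose proof (Hcl _ _ _ _ _ _ _ Hnn Hv' H2' Hv).
    rewrite (pre_dist_sym v v'). lra.
- exists p. intros eps Heps. destruct (Hu (eps / 4)) as [n0 Hn0]; [lra|].
  exists n0. intros n Hn.
  destruct (point_small (u n) (e := eps / 4)) as [v Hv]; [lra|].
  assert (Hpv : p v <= eps / 2).
  { apply Hp. exists n, (eps / 4), (eps / 4). repeat split; [exact Hv| |lra].
    intros m Hm. left. apply Hn0; [exact Hn|lia]. }
  pose proof (point_norm_minus_le (u n) p v v) as H.
  rewrite pre_dist_refl in H. lra.
Qed.

Definition completion : BanachSpace :=
  mk_banach point_norm_plus point_norm_scal point_norm_zero point_complete.

Definition completion_in (v : V) : completion := point_in v.

Lemma completion_in_eq v w : D v w = 0 -> completion_in v = completion_in w.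
Proof. exact (@point_in_eq v w). Qed.

Lemma completion_in_plus v w :
  completion_in (v +' w) = plus (completion_in v) (completion_in w).
Proof.
apply point_eq. intros e He. exists (v +' w), (v +' w). simpl.
rewrite pre_dist_refl.
pose proof (point_plus_spec (point_in v) (point_in w) v w) as H. simpl in H.
rewrite !pre_dist_refl in H.
change (plus (completion_in v) (completion_in w)) with
  (point_plus (point_in v) (point_in w)). lra.
Qed.

Lemma completion_in_scal (k : C) v :
  completion_in (k *' v) = scal k (completion_in v).
Proof.
apply point_eq. intros e He. exists (k *' v), (k *' v). simpl.
rewrite pre_dist_refl.
pose proof (point_scal_spec k (point_in v) v) as H. simpl in H.
rewrite !pre_dist_refl in H.
change (scal k (completion_in v)) with (point_scal k (point_in v)). lra.
Qed.

Lemma completion_ext (Y : BanachSpace) (S T : BoundedOp completion Y) :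
  (forall v, S (completion_in v) = T (completion_in v)) ->
  forall x, S x = T x.
Proof.
intros H x. apply norm_minus_small_eq. intros eps Heps.
destruct (op_bound (minus_op S T)) as [M [HM HST]].
destruct (point_small x (e := eps / M)) as [v Hv].
{ now apply Rdiv_lt_0_compat. }
set (d := minus x (completion_in v)).
assert (Hd : norm d <= eps / M).
{ eapply Rle_trans; [apply (point_norm_minus_le x (point_in v) v v)|].
  simpl. rewrite !pre_dist_refl. lra. }
apply norm_le_eq with (y := minus_op S T d).
- simpl. unfold d. rewrite !op_minus, H. lin.
- eapply Rle_trans; [apply HST|].
  apply Rle_trans with (M * (eps / M)); [|right; field; lra].
  apply Rmult_le_compat_l; lra.
Qed.

Lemma completion_bound (Y : BanachSpace) (S : BoundedOp completion Y) (M : R) :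
  0 <= M -> (forall v, norm (S (completion_in v)) <= M * D v 0') ->
  forall x, norm (S x) <= M * norm x.
Proof.
intros HM H x. apply le_epsilon. intros eps Heps.
destruct (op_bound S) as [K [HK HS]].
assert (HKM : 0 < K + M) by lra.
destruct (point_small x (e := eps / (K + M))) as [v Hv].
{ now apply Rdiv_lt_0_compat. }
set (e := point_dist x v) in *.
norm_as (plus (S (minus x (completion_in v))) (S (completion_in v))).
{ rewrite op_minus. lin. }
eapply Rle_trans; [apply norm_plus_le|].
apply Rle_trans with (K * e + M * (norm x + e)).
- apply Rplus_le_compat.
  + eapply Rle_trans; [apply HS|]. apply Rmult_le_compat_l; [lra|].
    eapply Rle_trans; [apply (point_norm_minus_le x (point_in v) v v)|].
    simpl. rewrite !pre_dist_refl. fold e. lra.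
  + eapply Rle_trans; [apply H|]. apply Rmult_le_compat_l; [exact HM|].
    rewrite Rplus_comm. exact (point_between x v 0').
- assert ((K + M) * e <= eps).
  { apply Rle_trans with ((K + M) * (eps / (K + M))); [|right; field; lra].
    apply Rmult_le_compat_l; lra. }
  lra.
Qed.

Section Extend.

Variable Y : BanachSpace.
Variable f : V -> Y.
Variable M : R.
Hypothesis M_pos : 0 < M.
Hypothesis f_zero : f 0' = zero.
Hypothesis f_plus : forall v w, f (v +' w) = plus (f v) (f w).
Hypothesis f_scal : forall (k : C) v, f (k *' v) = scal k (f v).
Hypothesis f_lip : forall v w, norm (minus (f v) (f w)) <= M * D v w.

(** The value at [p] is the limit of [f] along approximations of [p]; the
    estimate characterizes it and makes [extend] linear. *)
Lemma extend_point p : exists y : Y, forall v, norm (minus y (f v)) <= M * p v.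
Proof.
assert (Hpos : forall n, 0 < / (INR n + 1)).
{ intros n. apply Rinv_0_lt_compat. pose proof (pos_INR n). lra. }
set (s := fun n => proj1_sig
  (constructive_indefinite_description _ (point_small p (Hpos n)))).
assert (Hs : forall n, p (s n) <= / (INR n + 1)).
{ intros n. exact (proj2_sig
    (constructive_indefinite_description _ (point_small p (Hpos n)))). }
assert (Hsmall : forall eps, 0 < eps -> exists n0, forall n, (n0 <= n)%nat ->
  M * p (s n) < eps).
{ intros eps Heps.
  destruct (archimed_cor1 (eps / M)) as [n0 [H0 Hn0]].
  { now apply Rdiv_lt_0_compat. }
  exists n0. intros n Hn.
  apply Rle_lt_trans with (M * / INR n0).
  - apply Rmult_le_compat_l; [lra|]. eapply Rle_trans; [apply Hs|].
    apply Rinv_le_contravar; [now apply lt_0_INR|].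
    apply le_INR in Hn. lra.
  - apply Rlt_le_trans with (M * (eps / M)); [|right; field; lra].
    now apply Rmult_lt_compat_l. }
assert (Hdist : forall v w, norm (minus (f v) (f w)) <= M * p v + M * p w).
{ intros v w. eapply Rle_trans; [apply f_lip|].
  rewrite <- Rmult_plus_distr_l. apply Rmult_le_compat_l; [lra|].
  apply point_between. }
destruct (banach_cauchy_seq (u := fun n => f (s n))) as [y Hy].
{ intros eps Heps. destruct (Hsmall (eps / 2)) as [n0 Hn0]; [lra|].
  exists n0. intros n m Hn Hm. eapply Rle_lt_trans; [apply Hdist|].
  pose proof (Hn0 n Hn). pose proof (Hn0 m Hm). lra. }
exists y. intros v. apply le_epsilon. intros eps Heps.
destruct (Hy (eps / 2)) as [n1 H1]; [lra|].
destruct (Hsmall (eps / 2)) as [n2 H2]; [lra|].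
set (n := max n1 n2).
specialize (H1 n ltac:(lia)). specialize (H2 n ltac:(lia)).
eapply Rle_trans; [apply (norm_minus_triangle _ (f (s n)))|].
rewrite norm_minus_sym. specialize (Hdist (s n) v).
apply Rle_trans with (eps / 2 + (eps / 2 + M * p v)); [|lra].
apply Rplus_le_compat; [left; exact H1|]. lra.
Qed.

Definition extend_fun (x : completion) : Y :=
  proj1_sig (constructive_indefinite_description _ (extend_point x)).

Lemma extend_fun_spec (x : completion) v :
  norm (minus (extend_fun x) (f v)) <= M * point_dist x v.
Proof.
exact (proj2_sig (constructive_indefinite_description _ (extend_point x)) v).
Qed.

Lemma extend_fun_in v : extend_fun (completion_in v) = f v.
Proof.
apply norm_minus_small_eq. intros eps Heps.
eapply Rle_trans; [apply extend_fun_spec|].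
simpl. rewrite pre_dist_refl. lra.
Qed.

Lemma extend_fun_linear : is_linear extend_fun.
Proof.
apply mk_linear.
- intros x y. apply norm_minus_small_eq. intros eps Heps.
  assert (He : 0 < eps / (4 * M)) by (apply Rdiv_lt_0_compat; lra).
  destruct (point_small x He) as [v Hv].
  destruct (point_small y He) as [w Hw].
  pose proof (extend_fun_spec x v) as H1.
  pose proof (extend_fun_spec y w) as H2.
  pose proof (extend_fun_spec (plus x y) (v +' w)) as H3.
  rewrite f_plus in H3.
  pose proof (point_plus_le Hv Hw) as H4.
  change (point_plus x y) with (plus x y) in H4.
  assert (E : M * (eps / (4 * M)) = eps / 4) by (field; lra).
  assert (B1 : M * point_dist x v <= eps / 4).
  { rewrite <- E. apply Rmult_le_compat_l; [lra|exact Hv]. }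
  assert (B2 : M * point_dist y w <= eps / 4).
  { rewrite <- E. apply Rmult_le_compat_l; [lra|exact Hw]. }
  assert (B3 : M * point_dist (plus x y) (v +' w) <= eps / 4 + eps / 4).
  { rewrite <- E, <- Rmult_plus_distr_l. apply Rmult_le_compat_l; [lra|exact H4]. }
  norm_as (minus (minus (extend_fun (plus x y)) (plus (f v) (f w)))
    (plus (minus (extend_fun x) (f v)) (minus (extend_fun y) (f w)))).
  eapply Rle_trans; [apply norm_minus_le|].
  eapply Rle_trans; [apply Rplus_le_compat_l, norm_plus_le|]. lra.
- intros k x. apply norm_minus_small_eq. intros eps Heps.
  pose proof (Cmod_ge_0 k) as Hk.
  set (K := 2 * (Cmod k + 1) * M).
  assert (HK : 0 < K).
  { unfold K. apply Rmult_lt_0_compat; lra. }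
  assert (He : 0 < eps / K) by now apply Rdiv_lt_0_compat.
  destruct (point_small x He) as [v Hv].
  pose proof (extend_fun_spec x v) as H1.
  pose proof (extend_fun_spec (scal k x) (k *' v)) as H2.
  rewrite f_scal in H2.
  pose proof (point_scal_le k Hv) as H3.
  change (point_scal k x) with (scal k x) in H3.
  assert (E : M * ((Cmod k + 1) * (eps / K)) = eps / 2).
  { unfold K. field. split; lra. }
  assert (B : M * (Cmod k * (eps / K)) <= eps / 2).
  { rewrite <- E. apply Rmult_le_compat_l; [lra|].
    apply Rmult_le_compat_r; lra. }
  norm_as (minus (minus (extend_fun (scal k x)) (scal k (f v)))
    (scal k (minus (extend_fun x) (f v)))).
  eapply Rle_trans; [apply norm_minus_le|].
  replace eps with (eps / 2 + eps / 2) by field.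
  apply Rplus_le_compat.
  + eapply Rle_trans; [exact H2|]. eapply Rle_trans; [|exact B].
    apply Rmult_le_compat_l; [lra|exact H3].
  + eapply Rle_trans; [apply (@norm_scal C_AbsRing Y)|].
    eapply Rle_trans; [|exact B].
    replace (M * (Cmod k * (eps / K))) with (Cmod k * (M * (eps / K))) by ring.
    apply Rmult_le_compat_l; [exact Hk|].
    eapply Rle_trans; [exact H1|]. apply Rmult_le_compat_l; [lra|exact Hv].
- exists M. intros x. pose proof (extend_fun_spec x 0') as H.
  rewrite f_zero in H. eapply Rle_trans; [|exact H].
  apply Req_le, (f_equal norm). lin.
Qed.

Definition extend : BoundedOp completion Y :=
  {| op_fun := extend_fun; op_linear := extend_fun_linear |}.

End Extend.

End Completion.

(** * Projective tensor products *)

Section Tensor.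

Variables E F : BanachSpace.

Fixpoint formal_eval (Y : BanachSpace) (b : E -> F -> Y) (v : list (E * F)) : Y :=
  match v with
  | nil => zero
  | x :: v => plus (b (fst x) (snd x)) (formal_eval b v)
  end.

Definition contractive_bilinear (Y : BanachSpace) (b : E -> F -> Y) : Prop :=
  is_bilinear b /\ forall x y, norm (b x y) <= norm x * norm y.

(** The projective seminorm of the difference of two formal sums, in its dual
    description as the largest value under a contractive bilinear map. With
    vector-valued maps the universal property is immediate, without the
    Hahn-Banach theorem; as the quantification over the spaces [Y] is
    propositional, the tensor product stays in the universe of its factors. *)
Definition formal_dist (v w : list (E * F)) : R :=
  real (Lub_Rbar (fun r => exists (Y : BanachSpace) (b : E -> F -> Y),
    contractive_bilinear b /\
    r = norm (minus (formal_eval b v) (formal_eval b w)))).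

Fixpoint formal_mass (v : list (E * F)) : R :=
  match v with
  | nil => 0
  | x :: v => norm (fst x) * norm (snd x) + formal_mass v
  end.

Lemma formal_eval_mass (Y : BanachSpace) (b : E -> F -> Y) v :
  contractive_bilinear b -> norm (formal_eval b v) <= formal_mass v.
Proof.
intros [_ Hb]. induction v as [|[x y] v IH]; simpl.
- rewrite norm_0; lra.
- eapply Rle_trans; [apply norm_plus_le|]. specialize (Hb x y). lra.
Qed.

Lemma formal_dist_le v w c :
  0 <= c ->
  (forall (Y : BanachSpace) (b : E -> F -> Y), contractive_bilinear b ->
     norm (minus (formal_eval b v) (formal_eval b w)) <= c) ->
  formal_dist v w <= c.
Proof.
intros Hc H. apply Lub_Rbar_le; [exact Hc|].
intros r (Y & b & Hb & ->). now apply H.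
Qed.

Lemma formal_dist_ge (Y : BanachSpace) (b : E -> F -> Y) v w :
  contractive_bilinear b ->
  norm (minus (formal_eval b v) (formal_eval b w)) <= formal_dist v w.
Proof.
intros Hb. apply Lub_Rbar_ge with (c := formal_mass v + formal_mass w).
- intros r (Z & b' & Hb' & ->). eapply Rle_trans; [apply norm_minus_le|].
  pose proof (formal_eval_mass v Hb'). pose proof (formal_eval_mass w Hb'). lra.
- now exists Y, b.
Qed.

Lemma formal_dist_pos v w : 0 <= formal_dist v w.
Proof.
assert (H0 : contractive_bilinear (fun (_ : E) (_ : F) => zero : E)).
{ split; [split; intros; lin|]. intros x y. rewrite norm_0.
  apply Rmult_le_pos; apply norm_pos. }
eapply Rle_trans; [apply norm_pos|apply (formal_dist_ge v w H0)].
Qed.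

Lemma formal_dist_zero v w :
  (forall (Y : BanachSpace) (b : E -> F -> Y), is_bilinear b ->
     formal_eval b v = formal_eval b w) ->
  formal_dist v w = 0.
Proof.
intros H. apply Rle_antisym; [|apply formal_dist_pos].
apply formal_dist_le; [lra|]. intros Y b [Hb _]. rewrite (H Y b Hb).
norm_as (zero : Y). rewrite norm_0; lra.
Qed.

Lemma formal_dist_sym_le v w : formal_dist v w <= formal_dist w v.
Proof.
apply formal_dist_le; [apply formal_dist_pos|]. intros Y b Hb.
rewrite norm_minus_sym. now apply formal_dist_ge.
Qed.

Lemma formal_dist_sym v w : formal_dist v w = formal_dist w v.
Proof. apply Rle_antisym; apply formal_dist_sym_le. Qed.

Lemma formal_dist_tri u v w :
  formal_dist u w <= formal_dist u v + formal_dist v w.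
Proof.
apply formal_dist_le.
- apply Rplus_le_le_0_compat; apply formal_dist_pos.
- intros Y b Hb.
  eapply Rle_trans; [apply (norm_minus_triangle _ (formal_eval b v))|].
  apply Rplus_le_compat; now apply formal_dist_ge.
Qed.

Definition formal_scal (k : C) (v : list (E * F)) : list (E * F) :=
  map (fun x => (scal k (fst x), snd x)) v.

Lemma formal_eval_app (Y : BanachSpace) (b : E -> F -> Y) v w :
  formal_eval b (v ++ w) = plus (formal_eval b v) (formal_eval b w).
Proof. induction v as [|x v IH]; simpl; [lin|]. rewrite IH. lin. Qed.

Lemma formal_eval_scal (Y : BanachSpace) (b : E -> F -> Y) k v :
  is_bilinear b -> formal_eval b (formal_scal k v) = scal k (formal_eval b v).
Proof.
intros Hb. induction v as [|x v IH]; simpl; [lin|].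
rewrite (bilinear_scal_l Hb), IH. lin.
Qed.

Lemma formal_dist_plus v v' w w' :
  formal_dist (v ++ v') (w ++ w') <= formal_dist v w + formal_dist v' w'.
Proof.
apply formal_dist_le.
- apply Rplus_le_le_0_compat; apply formal_dist_pos.
- intros Y b Hb. rewrite !formal_eval_app.
  norm_as (plus (minus (formal_eval b v) (formal_eval b w))
    (minus (formal_eval b v') (formal_eval b w'))).
  eapply Rle_trans; [apply norm_plus_le|].
  apply Rplus_le_compat; now apply formal_dist_ge.
Qed.

Lemma formal_dist_scal k v w :
  formal_dist (formal_scal k v) (formal_scal k w) <= Cmod k * formal_dist v w.
Proof.
apply formal_dist_le.
- apply Rmult_le_pos; [apply Cmod_ge_0|apply formal_dist_pos].
- intros Y b Hb. rewrite !formal_eval_scal by apply Hb.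
  norm_as (scal k (minus (formal_eval b v) (formal_eval b w))).
  eapply Rle_trans; [apply (@norm_scal C_AbsRing Y)|].
  apply Rmult_le_compat_l; [apply Cmod_ge_0|now apply formal_dist_ge].
Qed.

Definition formal_pre : PreBanach.
Proof.
refine (@Build_PreBanach (list (E * F)) nil (@app _) formal_scal formal_dist
  _ formal_dist_sym formal_dist_tri formal_dist_plus formal_dist_scal
  _ _ _ _ _ _ _ _);
abstract (intros; apply formal_dist_zero; intros Y b Hb;
  rewrite ?formal_eval_app, ?formal_eval_scal, ?formal_eval_app,
    ?formal_eval_scal by exact Hb; simpl; lin).
Defined.

Definition tensor : BanachSpace := completion formal_pre.

Definition tens (x : E) (y : F) : tensor :=
  completion_in ((x, y) :: nil : formal_pre).

Lemma tens_norm x y : norm (tens x y) <= norm x * norm y.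
Proof.
apply formal_dist_le.
- apply Rmult_le_pos; apply norm_pos.
- intros Y b [_ Hb]. simpl. norm_as (b x y). apply Hb.
Qed.

Lemma tens_bilinear : is_bilinear tens.
Proof.
split; intros.
- etransitivity; [|exact (@completion_in_plus formal_pre ((x, y) :: nil)
    ((x', y) :: nil))].
  apply completion_in_eq, formal_dist_zero; intros Y b Hb; simpl.
  rewrite (bilinear_plus_l Hb). lin.
- exact (@completion_in_scal formal_pre k ((x, y) :: nil)).
- etransitivity; [|exact (@completion_in_plus formal_pre ((x, y) :: nil)
    ((x, y') :: nil))].
  apply completion_in_eq, formal_dist_zero; intros Y b Hb; simpl.
  rewrite (bilinear_plus_r Hb). lin.
- etransitivity; [|exact (@completion_in_scal formal_pre k ((x, y) :: nil))].
  apply completion_in_eq, formal_dist_zero; intros Y b Hb; simpl.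
  rewrite (bilinear_scal_r Hb), (bilinear_scal_l Hb). lin.
Qed.

Lemma op_formal (Y : BanachSpace) (S : BoundedOp tensor Y) (v : formal_pre) :
  S (completion_in v) = formal_eval (fun x y => S (tens x y)) v.
Proof.
induction v as [|[x y] v IH]; simpl.
- apply (op_zero S).
- rewrite <- IH, <- op_plus. f_equal.
  exact (@completion_in_plus formal_pre ((x, y) :: nil) v).
Qed.

Lemma tensor_ext (Y : BanachSpace) (S T : BoundedOp tensor Y) :
  (forall x y, S (tens x y) = T (tens x y)) -> forall t, S t = T t.
Proof.
intros H. apply completion_ext. intros v. rewrite !op_formal.
f_equal. apply functional_extensionality; intros x.
apply functional_extensionality; intros y. apply H.
Qed.

Section Lift.

Variable Y : BanachSpace.
Variable b : E -> F -> Y.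
Hypothesis b_bil : is_bilinear b.

Lemma formal_eval_lip (M : R) v w :
  0 < M -> (forall x y, norm (b x y) <= M * norm x * norm y) ->
  norm (minus (formal_eval b v) (formal_eval b w)) <= M * formal_dist v w.
Proof.
intros HM Hb.
set (b' := fun x y => scal (RtoC (/ M)) (b x y)).
assert (Hb' : contractive_bilinear b').
{ unfold b'. split; [split; intros|].
  - rewrite (bilinear_plus_l b_bil). lin.
  - rewrite (bilinear_scal_l b_bil). lin.
  - rewrite (bilinear_plus_r b_bil). lin.
  - rewrite (bilinear_scal_r b_bil). lin.
  - intros x y. eapply Rle_trans.
    + apply norm_scal_real. left. now apply Rinv_0_lt_compat.
    + apply Rmult_le_reg_l with M; [exact HM|].
      rewrite <- Rmult_assoc, Rinv_r, Rmult_1_l by lra.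
      rewrite <- Rmult_assoc. apply Hb. }
assert (Heval : forall u, formal_eval b' u = scal (RtoC (/ M)) (formal_eval b u)).
{ induction u as [|x u IH]; simpl; [lin|]. rewrite IH. unfold b'. lin. }
pose proof (formal_dist_ge v w Hb') as H. rewrite !Heval in H.
eapply norm_le_eq;
  [symmetry; exact (scal_inv (minus (formal_eval b v) (formal_eval b w))
     (Rgt_not_eq _ _ HM))|].
eapply Rle_trans; [apply norm_scal_real; lra|].
apply Rmult_le_compat_l; [lra|].
eapply Rle_trans; [|exact H]. apply Req_le, (f_equal norm). lin.
Qed.

Lemma tensor_lift_ex :
  (exists M, forall x y, norm (b x y) <= M * norm x * norm y) ->
  exists L : BoundedOp tensor Y, forall x y, L (tens x y) = b x y.
Proof.
intros [M HM].
assert (HM1 : 0 < Rabs M + 1) by (pose proof (Rabs_pos M); lra).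
assert (HM2 : forall x y, norm (b x y) <= (Rabs M + 1) * norm x * norm y).
{ intros x y. eapply Rle_trans; [apply HM|].
  rewrite !Rmult_assoc. apply Rmult_le_compat_r.
  - apply Rmult_le_pos; apply norm_pos.
  - pose proof (Rle_abs M); lra. }
exists (@extend formal_pre Y (formal_eval b) (Rabs M + 1) HM1 eq_refl
  (formal_eval_app b) (fun k v => formal_eval_scal k v b_bil)
  (fun v w => formal_eval_lip v w HM1 HM2)).
intros x y. etransitivity; [apply extend_fun_in|]. simpl. lin.
Qed.

Hypothesis b_bound : exists M, forall x y, norm (b x y) <= M * norm x * norm y.

Definition tensor_lift : BoundedOp tensor Y :=
  proj1_sig (constructive_indefinite_description _ (tensor_lift_ex b_bound)).

Lemma tensor_lift_tens x y : tensor_lift (tens x y) = b x y.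
Proof.
exact (proj2_sig
  (constructive_indefinite_description _ (tensor_lift_ex b_bound)) x y).
Qed.

End Lift.

(** [formal_eval_lip] wants a positive constant, so it is applied with
    [M + d] for small [d]. *)
Lemma tensor_op_bound (Y : BanachSpace) (L : BoundedOp tensor Y) (M : R) :
  0 <= M -> (forall x y, norm (L (tens x y)) <= M * norm x * norm y) ->
  forall t, norm (L t) <= M * norm t.
Proof.
intros HM HL.
assert (Hbil : is_bilinear (fun x y => L (tens x y))).
{ split; intros.
  - now rewrite (bilinear_plus_l tens_bilinear), op_plus.
  - now rewrite (bilinear_scal_l tens_bilinear), op_scal.
  - now rewrite (bilinear_plus_r tens_bilinear), op_plus.
  - now rewrite (bilinear_scal_r tens_bilinear), op_scal. }
apply completion_bound; [exact HM|]. intros v.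
apply le_epsilon. intros eps Heps.
pose proof (formal_dist_pos v nil) as Hd.
set (d := eps / (formal_dist v nil + 1)).
assert (Hd0 : 0 < d) by (apply Rdiv_lt_0_compat; lra).
rewrite op_formal.
assert (H : norm (minus (formal_eval (fun x y => L (tens x y)) v)
  (formal_eval (fun x y => L (tens x y)) nil)) <= (M + d) * formal_dist v nil).
{ apply formal_eval_lip; [exact Hbil|lra|].
  intros x y. eapply Rle_trans; [apply HL|].
  rewrite !Rmult_assoc. apply Rmult_le_compat_r; [|lra].
  apply Rmult_le_pos; apply norm_pos. }
norm_as (minus (formal_eval (fun x y => L (tens x y)) v) zero).
eapply Rle_trans; [exact H|].
assert (d * formal_dist v nil <= eps).
{ apply Rle_trans with (d * (formal_dist v nil + 1)).
  - apply Rmult_le_compat_l; lra.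
  - right. unfold d. field. lra. }
change (pre_dist v (pre_zero formal_pre)) with (formal_dist v nil). lra.
Qed.

End Tensor.

(** * Free modules *)

Section Free.

Variable A : BanachAlgebra.

Section ActLift.

Variable E : BanachSpace.
Variable M : LeftModule A.
Variable T : BoundedOp E M.

Lemma act_op_bilinear : is_bilinear (fun (a : A) (x : E) => act a (T x)).
Proof.
split; intros.
- apply (bilinear_plus_l (@act_bilinear A M)).
- apply (bilinear_scal_l (@act_bilinear A M)).
- now rewrite op_plus, act_plus.
- now rewrite op_scal, act_scal.
Qed.

Lemma act_op_bound : exists K, forall (a : A) (x : E),
  norm (act a (T x)) <= K * norm a * norm x.
Proof.
destruct (act_bound M) as [N [HN HM]], (op_bound T) as [P [HP HT]].
exists (N * P). intros a x. eapply Rle_trans; [apply HM|].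
replace (N * P * norm a * norm x) with (N * norm a * (P * norm x)) by ring.
apply Rmult_le_compat_l; [|apply HT].
apply Rmult_le_pos; [lra|apply norm_pos].
Qed.

Definition act_lift : BoundedOp (tensor A E) M :=
  tensor_lift act_op_bilinear act_op_bound.

Lemma act_lift_tens (a : A) (x : E) : act_lift (tens a x) = act a (T x).
Proof. exact (tensor_lift_tens act_op_bilinear act_op_bound a x). Qed.

End ActLift.

Lemma act_linear (M : LeftModule A) (a : A) : is_linear (fun x : M => act a x).
Proof.
destruct (act_bound M) as [N [HN HM]].
apply mk_linear.
- intros x y. apply act_plus.
- intros k x. apply act_scal.
- exists (N * norm a). apply HM.
Qed.

Definition act_op (M : LeftModule A) (a : A) : BoundedOp M M :=
  {| op_fun := fun x : M => act a x; op_linear := act_linear M a |}.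

Section LeftMultiplication.

Variable E : BanachSpace.

Lemma lmul_bilinear (a : A) :
  is_bilinear (fun (b : A) (x : E) => tens (alg_mul a b) x).
Proof.
split; intros.
- now rewrite (bilinear_plus_r (@alg_mul_bilinear A)),
    (bilinear_plus_l (tens_bilinear A E)).
- now rewrite (bilinear_scal_r (@alg_mul_bilinear A)),
    (bilinear_scal_l (tens_bilinear A E)).
- apply (bilinear_plus_r (tens_bilinear A E)).
- apply (bilinear_scal_r (tens_bilinear A E)).
Qed.

Lemma lmul_tens_norm (a b : A) (x : E) :
  norm (tens (alg_mul a b) x) <= norm a * norm b * norm x.
Proof.
eapply Rle_trans; [apply tens_norm|].
apply Rmult_le_compat_r; [apply norm_pos|apply alg_mul_norm].
Qed.

Lemma lmul_bound (a : A) : exists M, forall (b : A) (x : E),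
  norm (tens (alg_mul a b) x) <= M * norm b * norm x.
Proof. exists (norm a). apply lmul_tens_norm. Qed.

Definition lmul (a : A) : BoundedOp (tensor A E) (tensor A E) :=
  tensor_lift (lmul_bilinear a) (lmul_bound a).

Lemma lmul_tens (a b : A) (x : E) : lmul a (tens b x) = tens (alg_mul a b) x.
Proof. exact (tensor_lift_tens (lmul_bilinear a) (lmul_bound a) b x). Qed.

Lemma lmul_norm (a : A) t : norm (lmul a t) <= norm a * norm t.
Proof.
apply tensor_op_bound; [apply norm_pos|].
intros b x. rewrite lmul_tens. apply lmul_tens_norm.
Qed.

Lemma lmul_plus (a b : A) t : lmul (plus a b) t = plus (lmul a t) (lmul b t).
Proof.
apply (tensor_ext (S := lmul (plus a b)) (T := plus_op (lmul a) (lmul b))).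
intros c x. simpl. rewrite !lmul_tens.
now rewrite (bilinear_plus_l (@alg_mul_bilinear A)),
  (bilinear_plus_l (tens_bilinear A E)).
Qed.

Lemma lmul_scal (k : C) (a : A) t : lmul (scal k a) t = scal k (lmul a t).
Proof.
apply (tensor_ext (S := lmul (scal k a)) (T := scal_op k (lmul a))).
intros c x. simpl. rewrite !lmul_tens.
now rewrite (bilinear_scal_l (@alg_mul_bilinear A)),
  (bilinear_scal_l (tens_bilinear A E)).
Qed.

Lemma lmul_mul (a b : A) t : lmul (alg_mul a b) t = lmul a (lmul b t).
Proof.
apply (tensor_ext (S := lmul (alg_mul a b)) (T := comp_op (lmul a) (lmul b))).
intros c x. simpl. rewrite !lmul_tens. now rewrite alg_mul_assoc.
Qed.

(** [A_+ (x) E], split along [A_+ = C + A]. *)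
Definition free_act (a : A) (p : prod_space E (tensor A E)) :
    prod_space E (tensor A E) :=
  pair_in zero (plus (tens a (pfst p)) (lmul a (psnd p))).

Lemma free_act_bilinear : is_bilinear free_act.
Proof.
split; intros; unfold free_act; rewrite ?pair_in_plus, ?pair_in_scal;
  apply pair_in_eq; try lin.
- rewrite (bilinear_plus_l (tens_bilinear A E)), lmul_plus. lin.
- rewrite (bilinear_scal_l (tens_bilinear A E)), lmul_scal. lin.
- rewrite pfst_plus, psnd_plus, (bilinear_plus_r (tens_bilinear A E)), op_plus.
  lin.
- rewrite pfst_scal, psnd_scal, (bilinear_scal_r (tens_bilinear A E)), op_scal.
  lin.
Qed.

Lemma free_act_bound :
  exists M, forall a p, norm (free_act a p) <= M * norm a * norm p.
Proof.
exists 1. intros a [x t]. rewrite Rmult_1_l.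
change (norm (free_act a (x, t))) with
  (norm (zero : E) + norm (plus (tens a x) (lmul a t))).
change (norm ((x, t) : prod_space E (tensor A E))) with (norm x + norm t).
rewrite norm_0, Rplus_0_l. eapply Rle_trans; [apply norm_plus_le|].
rewrite Rmult_plus_distr_l.
apply Rplus_le_compat; [apply tens_norm|apply lmul_norm].
Qed.

Lemma free_act_assoc (a b : A) p :
  free_act (alg_mul a b) p = free_act a (free_act b p).
Proof.
unfold free_act. apply pair_in_eq; [reflexivity|].
change (plus (tens (alg_mul a b) (pfst p)) (lmul (alg_mul a b) (psnd p)) =
  plus (tens a zero) (lmul a (plus (tens b (pfst p)) (lmul b (psnd p))))).
rewrite (bil_zero_r (tens_bilinear A E)), op_plus, lmul_tens, lmul_mul. lin.
Qed.

Definition free_module : LeftModule A :=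
  mk_module free_act_bilinear free_act_bound free_act_assoc.

Definition free_in : BoundedOp E free_module := inl_op E (tensor A E).

Lemma free_act_in (a : A) (x : E) :
  act a (free_in x) = pair_in zero (tens a x) :> free_module.
Proof.
apply pair_in_eq; [reflexivity|].
change (plus (tens a x) (lmul a zero) = tens a x). rewrite op_zero. lin.
Qed.

Lemma free_decompose (p : free_module) :
  p = plus (free_in (pfst p)) (inr_op E (tensor A E) (psnd p)).
Proof.
destruct p as [x t].
transitivity (pair_in (plus x zero) (plus zero t)); [|reflexivity].
transitivity (pair_in x t); [reflexivity|]. apply pair_in_eq; lin.
Qed.

Section FreeLift.

Variable M : LeftModule A.
Variable T : BoundedOp E M.

Definition free_lift_op : BoundedOp free_module M :=
  plus_op (comp_op T (fst_op E (tensor A E)))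
    (comp_op (act_lift T) (snd_op E (tensor A E))).

Lemma act_lift_lmul (a : A) t : act_lift T (lmul a t) = act a (act_lift T t).
Proof.
apply (tensor_ext (S := comp_op (act_lift T) (lmul a))
  (T := comp_op (act_op M a) (act_lift T))).
intros b x. simpl. now rewrite lmul_tens, !act_lift_tens, act_assoc.
Qed.

Lemma free_lift_act (a : A) (p : free_module) :
  free_lift_op (act a p) = act a (free_lift_op p).
Proof.
simpl. rewrite op_zero, op_plus, act_lift_tens, act_lift_lmul, act_plus. lin.
Qed.

Definition free_lift : Hom free_module M :=
  {| hom_op := free_lift_op; hom_act := free_lift_act |}.

End FreeLift.

(** A morphism out of a free module is determined by its values on the
    generators, and these lift through a linear section. *)
Lemma free_projective : projective free_module.
Proof.
intros M N p [_ [s Hs]] f.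
set (T := comp_op s (comp_op f free_in)).
exists (free_lift T). intros q.
assert (Ht : forall t, p (act_lift T t) = f (inr_op E (tensor A E) t)).
{ apply (tensor_ext (S := comp_op p (act_lift T))
    (T := comp_op f (inr_op E (tensor A E) : BoundedOp (tensor A E) free_module))).
  intros a x.
  transitivity (p (act a (s (f (free_in x))))).
  - exact (f_equal p (act_lift_tens T a x)).
  - rewrite (hom_act p), Hs, <- (hom_act f).
    exact (f_equal f (free_act_in a x)). }
transitivity (plus (p (s (f (free_in (pfst q))))) (p (act_lift T (psnd q)))).
- apply (op_plus p).
- rewrite Hs, Ht, <- op_plus. f_equal. symmetry. apply free_decompose.
Qed.

End LeftMultiplication.

(** ** Syzygies *)

Section Syzygy.

Variable X : LeftModule A.

Definition counit : Hom (free_module X) X := free_lift (id_op X).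

Definition mul_map : BoundedOp (tensor A X) X := act_lift (id_op X).

Lemma mul_map_tens (a : A) (x : X) : mul_map (tens a x) = act a x.
Proof. exact (act_lift_tens (id_op X) a x). Qed.

Lemma mul_map_lmul (a : A) t : mul_map (lmul X a t) = act a (mul_map t).
Proof. exact (act_lift_lmul (id_op X) a t). Qed.

Definition syz_act (a : A) (t : tensor A X) : tensor A X :=
  minus (lmul X a t) (tens a (mul_map t)).

Lemma syz_act_bilinear : is_bilinear syz_act.
Proof.
split; intros; unfold syz_act.
- rewrite lmul_plus, (bilinear_plus_l (tens_bilinear A X)). lin.
- rewrite lmul_scal, (bilinear_scal_l (tens_bilinear A X)). lin.
- rewrite !op_plus, (bilinear_plus_r (tens_bilinear A X)). lin.
- rewrite !op_scal, (bilinear_scal_r (tens_bilinear A X)). lin.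
Qed.

Lemma syz_act_bound :
  exists M, forall a t, norm (syz_act a t) <= M * norm a * norm t.
Proof.
destruct (op_bound mul_map) as [K [HK Hm]].
exists (1 + K). intros a t. eapply Rle_trans; [apply norm_minus_le|].
replace ((1 + K) * norm a * norm t) with
  (norm a * norm t + norm a * (K * norm t)) by ring.
apply Rplus_le_compat; [apply lmul_norm|].
eapply Rle_trans; [apply tens_norm|].
apply Rmult_le_compat_l; [apply norm_pos|apply Hm].
Qed.

Lemma mul_map_syz_act (a : A) t : mul_map (syz_act a t) = zero.
Proof.
unfold syz_act. rewrite op_minus, mul_map_lmul, mul_map_tens. lin.
Qed.

Lemma syz_act_assoc (a b : A) t :
  syz_act (alg_mul a b) t = syz_act a (syz_act b t).
Proof.
unfold syz_act at 2. rewrite mul_map_syz_act, (bil_zero_r (tens_bilinear A X)).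
unfold syz_act. rewrite op_minus, lmul_mul, lmul_tens. lin.
Qed.

(** The kernel of [counit], carried over to [tensor A X] along the linear
    isomorphism [t |-> (- mul_map t, t)]. *)
Definition syzygy : LeftModule A :=
  mk_module syz_act_bilinear syz_act_bound syz_act_assoc.

Lemma syz_in_linear :
  is_linear (fun t : tensor A X => pair_in (opp (mul_map t)) t).
Proof.
destruct (op_bound mul_map) as [K [HK Hm]].
apply mk_linear.
- intros t u. rewrite pair_in_plus. apply pair_in_eq; [|reflexivity].
  rewrite op_plus. lin.
- intros k t. rewrite pair_in_scal. apply pair_in_eq; [|reflexivity].
  rewrite op_scal. lin.
- exists (K + 1). intros t. rewrite pair_norm, norm_opp_eq.
  specialize (Hm t). lra.
Qed.

Definition syz_in_op : BoundedOp syzygy (free_module X) :=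
  {| op_fun := fun t : tensor A X => pair_in (opp (mul_map t)) t;
     op_linear := syz_in_linear |}.

Lemma syz_in_act (a : A) (t : syzygy) :
  syz_in_op (act a t) = act a (syz_in_op t).
Proof.
apply pair_in_eq.
- change (opp (mul_map (syz_act a t)) = zero).
  rewrite mul_map_syz_act. lin.
- change (syz_act a t = plus (tens a (opp (mul_map t))) (lmul X a t)).
  rewrite (bil_opp_r (tens_bilinear A X)). unfold syz_act. lin.
Qed.

Definition syz_in : Hom syzygy (free_module X) :=
  {| hom_op := syz_in_op; hom_act := syz_in_act |}.

Lemma counit_syz_in t : counit (syz_in t) = zero.
Proof. simpl. unfold mul_map. lin. Qed.

Lemma counit_free_in (x : X) : counit (free_in X x) = x.
Proof. simpl. rewrite op_zero. lin. Qed.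

Definition free_proj : BoundedOp (free_module X) syzygy := snd_op X (tensor A X).

(** The linear splitting of [0 -> syzygy -> free_module X -> X -> 0]. Spliced,
    these splittings form the contracting homotopy of the resolution. *)
Lemma free_split (p : free_module X) :
  plus (free_in X (counit p)) (syz_in (free_proj p)) = p.
Proof.
destruct p as [x t].
transitivity (pair_in (plus (plus x (mul_map t)) (opp (mul_map t)))
  (plus zero t)); [reflexivity|].
transitivity (pair_in x t); [|reflexivity]. apply pair_in_eq; lin.
Qed.

End Syzygy.

(** ** A projective resolution *)

Section Resolution.

Variable X : LeftModule A.

Fixpoint syzygies (n : nat) : LeftModule A :=
  match n with
  | O => X
  | S m => syzygy (syzygies m)
  end.

Definition free_ob (n : nat) : LeftModule A := free_module (syzygies n).

Definition free_diff (n : nat) : Hom (free_ob (S n)) (free_ob n) :=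
  comp_hom (syz_in (syzygies n)) (counit (syzygies (S n))).

Lemma free_diff_diff (n : nat) x : free_diff n (free_diff (S n) x) = zero.
Proof.
transitivity (syz_in (syzygies n) zero); [|apply op_zero].
exact (f_equal (syz_in (syzygies n))
  (counit_syz_in (counit (syzygies (S (S n))) x))).
Qed.

Definition free_complex : ChainComplex A :=
  {| ob := free_ob; diff := free_diff; diff_diff := free_diff_diff |}.

Lemma counit_free_diff x : counit X (free_diff 0 x) = zero.
Proof. exact (counit_syz_in (counit (syzygies 1) x)). Qed.

Definition free_homotopy (n : nat) :
    BoundedOp (augment_ob free_complex X n) (augment_ob free_complex X (S n)) :=
  match n return
    BoundedOp (augment_ob free_complex X n) (augment_ob free_complex X (S n))
  with
  | O => free_in X
  | S m => comp_op (free_in (syzygies (S m))) (free_proj (syzygies m))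
  end.

Lemma free_admissible :
  admissible (@augment A free_complex X (counit X) counit_free_diff).
Proof.
exists free_homotopy. split.
- exact (@counit_free_in X).
- assert (H : forall m (x : free_ob m),
    plus (free_in (syzygies m) (counit (syzygies m) x))
      (free_diff m (free_homotopy (S m) x)) = x).
  { intros m x. rewrite <- (free_split x) at 3. f_equal.
    exact (f_equal (syz_in (syzygies m))
      (counit_free_in (free_proj (syzygies m) x))). }
  intros [|m] x; exact (H _ x).
Qed.

Definition free_resolution : ProjectiveResolution X :=
  {| res_complex := free_complex;
     res_projective := fun n => @free_projective (syzygies n);
     res_aug := counit X; res_aug_diff := counit_free_diff;
     res_admissible := free_admissible |}.

End Resolution.

(** ** Cocycles of the resolution *)

Section ResolutionCocycle.

Variables X Y : LeftModule A.
Variable f : Z1 X Y.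

Lemma z1_lift_bound : exists M, forall (a : A) (x : X),
  norm (f a x) <= M * norm a * norm x.
Proof. destruct (z1_bound f) as [M [_ HM]]. now exists M. Qed.

Definition z1_lift_op : BoundedOp (syzygy X) Y :=
  tensor_lift (@z1_bilinear A X Y f) z1_lift_bound.

Lemma z1_lift_tens (a : A) (x : X) : z1_lift_op (tens a x) = f a x.
Proof. exact (tensor_lift_tens (@z1_bilinear A X Y f) z1_lift_bound a x). Qed.

Lemma z1_lift_act (a : A) (t : syzygy X) :
  z1_lift_op (act a t) = act a (z1_lift_op t).
Proof.
apply (tensor_ext (S := comp_op z1_lift_op (act_op (syzygy X) a))
  (T := comp_op (act_op Y a) z1_lift_op)).
intros b x. simpl. unfold syz_act.
rewrite op_minus, lmul_tens, mul_map_tens, !z1_lift_tens, z1_eq. lin.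
Qed.

(** The cocycle identity of [f] is exactly equivariance of its linearization
    for the twisted action on [syzygy X]. *)
Definition z1_lift : Hom (syzygy X) Y :=
  {| hom_op := z1_lift_op; hom_act := z1_lift_act |}.

(** The differential sends the generator [tens a x] of the second free module
    to [a . [x] - [a . x]], where [[x]] is the generator [x] of the first.
    Hence a coboundary [h d_0] takes there the value of [delta0 T], where [T]
    is [h] on generators, while the cocycle induced by [f] takes the value
    [f a x]. *)
Lemma ext1_trivial_delta0 :
  Ext_topology_trivial 1 X Y ->
  forall eps, 0 < eps ->
  exists T : BoundedOp X Y, forall (a : A) (x : X),
    norm (minus (delta0 T a x) (f a x)) <= eps * norm a * norm x.
Proof.
intros HExt eps Heps.
set (c := comp_hom z1_lift (counit (syzygy X))).
destruct (HExt (free_resolution X) c) with (eps := eps)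
  as [g [[h Hh] Hg]]; [|exact Heps|].
{ intros p. transitivity (z1_lift zero); [|apply op_zero].
  exact (f_equal z1_lift (counit_syz_in (counit (syzygies X 2) p))). }
exists (comp_op h (free_in X)). intros a x.
set (z := free_in (syzygy X) (tens a x)).
assert (Hz : norm z <= norm a * norm x).
{ change (norm (tens a x : tensor A X) + norm (zero : tensor A (syzygy X)) <=
    norm a * norm x).
  rewrite norm_0, Rplus_0_r. apply tens_norm. }
assert (Hc : c z = f a x).
{ transitivity (z1_lift (tens a x)); [|apply z1_lift_tens].
  exact (f_equal z1_lift (counit_free_in (tens a x : syzygy X))). }
assert (Hgz : g z = delta0 (comp_op h (free_in X)) a x).
{ rewrite Hh.
  assert (E : diff (free_resolution X) 0 z =
    minus (act a (free_in X x)) (free_in X (act a x))).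
  { transitivity (syz_in X (tens a x)).
    - exact (f_equal (syz_in X) (counit_free_in (tens a x : syzygy X))).
    - rewrite free_act_in.
      transitivity (pair_in (opp (act a x)) (tens a x)).
      + apply pair_in_eq; [f_equal; apply mul_map_tens|reflexivity].
      + transitivity (pair_in (minus zero (act a x)) (minus (tens a x) zero)).
        * apply pair_in_eq; lin.
        * reflexivity. }
  rewrite E, op_minus, (hom_act h). reflexivity. }
rewrite norm_minus_sym, <- Hc, <- Hgz.
eapply Rle_trans; [apply (opnorm_bound (minus_op c g) z)|].
apply Rle_trans with (eps * norm z).
- apply Rmult_le_compat_r; [apply norm_pos|]. left; exact Hg.
- rewrite Rmult_assoc. apply Rmult_le_compat_l; lra.
Qed.

End ResolutionCocycle.

End Free.

Theorem theorem2p7 (A : BanachAlgebra) (I : LeftModule A) :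
  (* (i) <-> (ii) *)
  (injective I <->
   forall X : LeftModule A, Ext_topology_trivial 1 X I) /\
  (* (i) <-> (iii) *)
  (injective I <->
   forall (X Y : LeftModule A) (k : Hom Y X), admissible_mono k ->
   forall f : Hom Y I,
   exists (N : DirectedSet) (phi : N -> Hom X I),
     converges_in_opnorm (fun n y => phi n (k y)) f) /\
  (* (i) <-> the dense range form of (iii) *)
  (injective I <->
   forall (X Y : LeftModule A) (k : Hom Y X), admissible_mono k ->
   forall (f : Hom Y I) (eps : R), (0 < eps)%R ->
   exists g : Hom X I, (opnorm (fun y => minus (g (k y)) (f y)) < eps)%R) /\
  (* (i) <-> (iv) *)
  (injective I <->
   forall (X Y : LeftModule A) (k : Hom Y X), admissible_mono k ->
   forall f : Hom Y I,
   exists (N : DirectedSet) (psi : N -> BoundedOp X I),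
     uniform_approximate_morphism psi /\
     forall n y, psi n (k y) = f y) /\
  (* (i) <-> (v) *)
  (injective I <->
   forall (X Y : LeftModule A) (k : Hom Y X), admissible_mono k ->
   forall f : Hom Y I,
   exists (N : DirectedSet) (psi : N -> BoundedOp X I),
     uniform_approximate_morphism psi /\
     converges_in_opnorm (fun n y => psi n (k y)) f) /\
  (* (i) <-> (vi) *)
  (injective I <->
   exists (J : LeftModule A) (mu : Hom I J)
          (N : DirectedSet) (rho : N -> BoundedOp J I),
     injective J /\ admissible_mono mu /\
     uniform_approximate_morphism rho /\
     converges_in_opnorm (fun n x => rho n (mu x)) (fun x : I => x)) /\
  (* (i) <-> (vii) *)
  (injective I <->
   forall (X : LeftModule A) (f : Z1 X I),
   exists (N : DirectedSet) (T : N -> BoundedOp X I),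
     converges_in_bilnorm (fun n => delta0 (T n)) f).
Proof.
split; [|split; [|split; [|split; [|split; [|split]]]]]; split.
- intros HI X. now apply injective_ext1_trivial.
- intros H. apply univ_split_injective.
  destruct (ext1_trivial_delta0 (univ_cocycle I) (H (univ_module I))
    (eps := / 2) ltac:(lra)) as [T HT].
  apply (univ_split_of_approx (T := T) (c := / 2)); [lra|exact HT].
- intros HI X Y k Hk f. destruct (HI X Y k Hk f) as [g Hg].
  exists unit_net, (fun _ => g). now apply opnorm_net_exact.
- intros H. apply univ_split_injective.
  destruct (H _ _ _ (ext_incl_admissible (univ_cocycle I)) (id_hom I))
    as [N [phi Hphi]].
  apply (univ_split_of_net (psi := fun n => phi n)); [|exact Hphi].
  intros S T _ _ eps Heps. destruct (dir_inhabited N) as [n0].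
  exists n0. intros n _ a x _ _. rewrite (hom_act (phi n)).
  norm_as (zero : I). now rewrite norm_0.
- intros HI X Y k Hk f eps Heps. destruct (HI X Y k Hk f) as [g Hg].
  exists g. rewrite opnorm_zero; [exact Heps|]. intros y. rewrite Hg. lin.
- intros H. apply univ_split_injective.
  destruct (H _ _ _ (ext_incl_admissible (univ_cocycle I)) (id_hom I) (/ 2)
    ltac:(lra)) as [g Hg].
  apply (univ_split_of_retraction (psi := g) (c := / 2) (e := 0)); try lra.
  + intros y.
    eapply Rle_trans; [exact (opnorm_bound
      (minus_op (comp_op g (ext_incl (univ_cocycle I))) (id_op I)) y)|].
    apply Rmult_le_compat_r; [apply norm_pos|]. left; exact Hg.
  + intros a p. rewrite (hom_act g). norm_as (zero : I). rewrite norm_0. lra.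
- intros HI X Y k Hk f. destruct (HI X Y k Hk f) as [g Hg].
  exists unit_net, (fun _ => g : BoundedOp X I).
  split; [apply exact_uniform_approximate|]. intros _. exact Hg.
- intros H. apply univ_split_injective.
  destruct (H _ _ _ (ext_incl_admissible (univ_cocycle I)) (id_hom I))
    as [N [psi [Hua Hpsi]]].
  apply (univ_split_of_net Hua). now apply opnorm_net_exact.
- intros HI X Y k Hk f. destruct (HI X Y k Hk f) as [g Hg].
  exists unit_net, (fun _ => g : BoundedOp X I).
  split; [apply exact_uniform_approximate|]. now apply opnorm_net_exact.
- intros H. apply univ_split_injective.
  destruct (H _ _ _ (ext_incl_admissible (univ_cocycle I)) (id_hom I))
    as [N [psi [Hua Hpsi]]].
  exact (univ_split_of_net Hua Hpsi).
- intros HI. exists I, (id_hom I), unit_net, (fun _ => id_hom I : BoundedOp I I).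
  repeat split.
  + exact HI.
  + now exists (id_op I).
  + apply exact_uniform_approximate.
  + now apply opnorm_net_exact.
- intros (J & mu & N & rho & HJ & Hmu & Hua & Hconv).
  apply univ_split_injective.
  destruct (HJ _ _ _ (ext_incl_admissible (univ_cocycle I)) mu) as [theta Htheta].
  apply (univ_split_of_net (uniform_approximate_comp theta Hua)).
  replace (fun (n : N) (y : I) =>
    comp_op (rho n) theta (ext_incl (univ_cocycle I) y))
    with (fun (n : N) (y : I) => rho n (mu y)); [exact Hconv|].
  apply functional_extensionality; intros n.
  apply functional_extensionality; intros y.
  exact (f_equal (rho n) (eq_sym (Htheta y))).
- intros HI X f. destruct (injective_coboundary f HI) as [T HT].
  exists unit_net, (fun _ => T). apply constant_net_lim. intros _.
  apply bilnorm_zero. intros a x. rewrite HT. lin.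
- intros H. apply univ_split_injective.
  destruct (H _ (univ_cocycle I)) as [N [T HT]].
  exact (univ_split_of_delta0_net HT).
Qed.
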